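(* Let $A$ be an algebra without nonzero oriented cycles. Let $\phi$ be an automorphism of $\hat{A}$ with jump $0\neq n\in\mathbb{Z}$. Then $\hat{A}/\langle\phi\rangle$ and $T^n_{\phi_0}(A)$ are isomorphic as $\mathbb{Z}$-graded categories.
   Context: Conventions. $\Bbbk$ is an algebraically closed field, $D=\operatorname{Hom}_{\Bbbk}(-,\Bbbk)$; all categories and functors are $\Bbbk$-linear. All algebras are basic, connected, nonzero, finite-dimensional $\Bbbk$-algebras. An algebra $A$ is identified with the category with object set $A_0$, a fixed complete set of orthogonal primitive idempotents of $A$, with $A(x,y)=yAx$ and composition given by multiplication. Automorphisms of a category are ($\Bbbk$-linear) isomorphisms of the category onto itself. $A$ has no nonzero oriented cycles if $A(x,x)=\Bbbk$ for all $x\in A_0$. Repetitive category $\hat{A}$. Objects: $x^{[i]}:=(x,i)$ with $x\in A_0$, $i\in\mathbb{Z}$. Morphisms: $\hat{A}(x^{[i]},y^{[i]})=\{f^{[i]}\mid f\in A(x,y)\}$, $\hat{A}(x^{[i]},y^{[i+1]})=\{\beta^{[i]}\mid\beta\in D(A(y,x))\}$, all other morphism spaces zero. Composition is that of $A$, or the $A$-bimodule structure of $DA$ ($(\beta f)(u)=\beta(fu)$, $(f\beta)(u)=\beta(uf)$), and zero for two morphisms both raising the index. The Nakayama automorphism $\nu_A$ of $\hat{A}$ raises all indices $[i]$ to $[i+1]$. $A^{[i]}$ is the full subcategory on the objects $x^{[i]}$ $(x\in A_0)$, and $\mathrm{id}^{[i]}\colon A\to A^{[i]}$ is the isomorphism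 $x\mapsto x^{[i]}$, $f\mapsto f^{[i]}$. An automorphism $\phi$ of $\hat{A}$ has jump $n$ if $\phi(A^{[0]})=A^{[n]}$. For $\phi$ with jump $n$, $\phi_0:=(\mathrm{id}^{[0]})^{-1}\phi\,\nu_A^{-n}\,\mathrm{id}^{[0]}$, an automorphism of $A$. For an automorphism $\sigma$ of $A$, $\hat{\sigma}$ is the automorphism of $\hat{A}$ with $\hat\sigma(x^{[i]})=(\sigma x)^{[i]}$, $\hat\sigma(f^{[i]})=(\sigma f)^{[i]}$ and $\hat\sigma(\beta^{[i]})=(\beta\circ(\sigma|_{A(y,x)})^{-1})^{[i]}$ for $\beta\in D(A(y,x))$. The twisted $n$-fold extension is $T^n_{\sigma}(A):=\hat{A}/\langle\hat{\sigma}\nu_A^n\rangle$. Orbit categories. For an automorphism $g$ of $\hat{A}$ with jump $n\ne 0$, the action $k\mapsto g^k$ of $\mathbb{Z}$ on $\hat{A}$ is free and $\hat{A}/\langle g\rangle$ is the classical orbit category: its objects are the $\langle g\rangle$-orbits of objects; choosing orbit representatives, the morphism space from the orbit of $x$ to that of $y$ is $\bigoplus_{k\in\mathbb{Z}}\hat{A}(g^kx,y)$ ($x,y$ the representatives), with composition $(q_l)_l\cdot(f_k)_k=\big(\sum_{l+k=m}q_l\,g^l(f_k)\big)_m$. It is $\mathbb{Z}$-graded with degree-$k$ part $\hat{A}(g^kx,y)$. An isomorphism of $\mathbb{Z}$-graded categories $\mathcal{B}\to\mathcal{A}$ is an isomorphism of categories $H$ that is degree-preserving, i.e. for some map $r\colon\mathcal{B}_0\to\mathbb{Z}$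 one has $H(\mathcal{B}^{r_y+a}(x,y))\subseteq\mathcal{A}^{a+r_x}(Hx,Hy)$ for all $x,y\in\mathcal{B}_0$, $a\in\mathbb{Z}$. *)

(* Defs.v *)
From HB Require Import structures.
From mathcomp Require Import all_boot all_order all_algebra all_field.
From mathcomp Require Import boolp classical_sets functions cardinality fsbigop.

Set Implicit Arguments.
Unset Strict Implicit.
Unset Printing Implicit Defensive.

Import GRing.Theory.
Local Open Scope ring_scope.
Local Open Scope classical_set_scope.

Record linCat (k : fieldType) := LinCat {
  ob :> Type;
  hom : ob -> ob -> lmodType k;
  idm : forall x, hom x x;
  comp : forall x y z, hom y z -> hom x y -> hom x z;
  comp_linl : forall x y z (f : hom x y), linear (fun g : hom y z => comp g f);
  comp_linr : forall x y z (g : hom y z), linear (fun f : hom x y => comp g f);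
  comp1m : forall x y (f : hom x y), comp (idm y) f = f;
  compm1 : forall x y (f : hom x y), comp f (idm x) = f;
  compA : forall x y z t (h : hom z t) (g : hom y z) (f : hom x y),
    comp h (comp g f) = comp (comp h g) f
}.
Arguments hom {k C} x y : rename.
Arguments idm {k C} x : rename.
Arguments comp {k C x y z} g f : rename.

Record linFunctor (k : fieldType) (C D : linCat k) := LinFunctor {
  fob :> C -> D;
  fmap : forall x y, hom x y -> hom (fob x) (fob y);
  fmap_lin : forall x y, linear (@fmap x y);
  fmap1 : forall x, fmap (idm x) = idm (fob x);
  fmapM : forall x y z (g : hom y z) (f : hom x y),
    fmap (comp g f) = comp (fmap g) (fmap f)
}.
Arguments fmap {k C D} F {x y} f : rename.

(* A morphism bundled with its endpoints: equality of arrows compares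
   morphisms whose endpoints are only propositionally equal. *)
Definition arr (k : fieldType) (C : linCat k) (x y : C) (f : hom x y) :
  {p : C * C & hom p.1 p.2} := existT (fun p : C * C => hom p.1 p.2) (x, y) f.

Lemma arr_inj (k : fieldType) (C : linCat k) (x y : C) (f g : hom x y) :
  arr f = arr g -> f = g.
Proof.
move=> e; have := projT2_eq e.
by rewrite (Prop_irrelevance (projT1_eq e) erefl).
Qed.

Lemma arr_ob (k : fieldType) (C : linCat k) (x y x' y' : C)
    (f : hom x y) (f' : hom x' y') : arr f = arr f' -> x = x' /\ y = y'.
Proof. by move/(congr1 (@tag _ _)) => [-> ->]. Qed.

Lemma arr_comp (k : fieldType) (C : linCat k) (x y z x' y' z' : C)
    (g : hom y z) (f : hom x y) (g' : hom y' z') (f' : hom x' y') :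
  arr g = arr g' -> arr f = arr f' -> arr (comp g f) = arr (comp g' f').
Proof.
move=> eg ef; have [ey ez] := arr_ob eg; have [ex _] := arr_ob ef.
by subst; rewrite (arr_inj eg) (arr_inj ef).
Qed.

Lemma arr_fmap (k : fieldType) (C D : linCat k) (F : linFunctor C D)
    (x y x' y' : C) (f : hom x y) (f' : hom x' y') :
  arr f = arr f' -> arr (fmap F f) = arr (fmap F f').
Proof. by move=> e; have [ex ey] := arr_ob e; subst; rewrite (arr_inj e). Qed.

Lemma functor_eq (k : fieldType) (C D : linCat k) (F G : linFunctor C D) :
  (forall x y (f : hom x y), arr (fmap F f) = arr (fmap G f)) -> F = G.
Proof.
case: F G => [Fo Fm Fl F1 FM] [Go Gm Gl G1 GM] /= e.
have eo : Fo = Go.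
  by apply/funext => x; have [] := arr_ob (e x x (idm x)).
subst Go.
have em : Fm = Gm.
  by do 3 (apply: functional_extensionality_dep => ?); apply: arr_inj.
subst Gm; congr LinFunctor; exact: Prop_irrelevance.
Qed.

Definition fid (k : fieldType) (C : linCat k) : linFunctor C C.
Proof. by refine (@LinFunctor k C C id (fun x y f => f) _ _ _). Defined.

Definition fcomp (k : fieldType) (C D E : linCat k) (G : linFunctor D E)
  (F : linFunctor C D) : linFunctor C E.
Proof.
refine (@LinFunctor k C E (fun x => G (F x))
  (fun x y f => fmap G (fmap F f)) _ _ _).
- by move=> x y a f g; rewrite !fmap_lin.
- by move=> x; rewrite !fmap1.
- by move=> x y z g f; rewrite !fmapM.
Defined.

(* Isomorphisms, not equivalences: by functor_eq, equality of functors means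
   agreement on all objects and all morphisms. *)
Record catIso (k : fieldType) (C D : linCat k) := CatIso {
  isoF :> linFunctor C D;
  isoV : linFunctor D C;
  isoVK : fcomp isoV isoF = fid C;
  isoK : fcomp isoF isoV = fid D
}.

Definition iso1 (k : fieldType) (C : linCat k) : catIso C C :=
  @CatIso k C C (fid C) (fid C)
    (functor_eq (fun _ _ _ => erefl)) (functor_eq (fun _ _ _ => erefl)).

Definition isoInv (k : fieldType) (C D : linCat k) (F : catIso C D) :
  catIso D C := CatIso (isoK F) (isoVK F).

Lemma fcompA (k : fieldType) (C D E E' : linCat k) (H : linFunctor E E')
    (G : linFunctor D E) (F : linFunctor C D) :
  fcomp H (fcomp G F) = fcomp (fcomp H G) F.
Proof. exact: functor_eq. Qed.

Lemma fcomp1F (k : fieldType) (C D : linCat k) (F : linFunctor C D) :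
  fcomp (fid D) F = F.
Proof. exact: functor_eq. Qed.

Lemma fcompF1 (k : fieldType) (C D : linCat k) (F : linFunctor C D) :
  fcomp F (fid C) = F.
Proof. exact: functor_eq. Qed.

Definition isoComp (k : fieldType) (C D E : linCat k) (G : catIso D E)
  (F : catIso C D) : catIso C E.
Proof.
refine (@CatIso k C E (fcomp G F) (fcomp (isoV F) (isoV G)) _ _).
- by rewrite -fcompA (fcompA (isoV G)) isoVK fcomp1F isoVK.
- by rewrite -fcompA (fcompA F) isoK fcomp1F isoK.
Defined.

Definition isoPow (k : fieldType) (C : linCat k) (g : catIso C C) (n : int) :
  catIso C C :=
  match n with
  | Posz m => iter m (isoComp g) (iso1 C)
  | Negz m => iter m.+1 (isoComp (isoInv g)) (iso1 C)
  end.

Lemma isoPowS (k : fieldType) (C : linCat k) (g : catIso C C) (n : int) :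
  isoPow g (n + 1) = fcomp g (isoPow g n) :> linFunctor C C.
Proof.
case: n => [m|[|m]].
- by rewrite -PoszD addn1.
- by rewrite (_ : Negz 0 + 1 = 0) //= fcompF1 isoK.
- rewrite (_ : Negz m.+1 + 1 = Negz m); last by rewrite !NegzE -addn1 PoszD opprD addrNK.
  by rewrite [isoPow g (Negz m.+1)]/= fcompA isoK fcomp1F.
Qed.

Lemma isoPowD (k : fieldType) (C : linCat k) (g : catIso C C) (m n : int) :
  fcomp (isoPow g m) (isoPow g n) = isoPow g (m + n) :> linFunctor C C.
Proof.
have gI (F G : linFunctor C C) : fcomp g F = fcomp g G -> F = G.
  by move/(congr1 (fcomp (isoV g))); rewrite !fcompA !isoVK !fcomp1F.
elim: m => [|m IH|m IH].
- by rewrite add0r /= fcomp1F.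
- by rewrite -addn1 PoszD isoPowS -fcompA IH -isoPowS addrAC.
- apply: gI; rewrite fcompA -!isoPowS -addn1 PoszD opprD addrNK IH.
  by congr (isoF (isoPow g _)); rewrite addrAC addrNK.
Qed.

Record grCat (k : fieldType) := GrCat {
  gcat :> linCat k;
  deg : forall x y : gcat, int -> set (hom x y);
  deg0 : forall (x y : gcat) a, @deg x y a 0;
  degP : forall (x y : gcat) a c (f g : hom x y),
    deg a f -> deg a g -> deg a (c *: f + g);
  deg_sum : forall (x y : gcat) (f : hom x y),
    exists2 u : int -> hom x y,
      finite_set [set a | u a != 0] /\ (forall a, deg a (u a)) &
      f = \sum_(a \in [set: int]) u a;
  deg_free : forall (x y : gcat) (u : int -> hom x y),
    finite_set [set a | u a != 0] -> (forall a, deg a (u a)) ->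
    \sum_(a \in [set: int]) u a = 0 -> forall a, u a = 0;
  deg_comp : forall (x y z : gcat) a b (g : hom y z) (f : hom x y),
    deg b g -> deg a f -> deg (b + a) (comp g f)
}.
Arguments deg {k C} x y a : rename.

Definition degree_preserving (k : fieldType) (B A : grCat k)
  (H : linFunctor B A) : Prop :=
  exists r : B -> int, forall (x y : B) (a : int),
    [set fmap H f | f in deg x y (r y + a)] `<=` deg (H x) (H y) (a + r x).

Definition gr_isomorphic (k : fieldType) (B A : grCat k) : Prop :=
  exists H : catIso B A, degree_preserving H.

Record dsum (k : fieldType) (V : int -> lmodType k) := DSum {
  dval :> forall i, V i;
  dval_fin : finite_set [set i | dval i != 0]
}.

Lemma dsumP (k : fieldType) (V : int -> lmodType k) (u v : dsum V) :
  (forall i, u i = v i) -> u = v.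
Proof.
case: u v => [u uf] [v vf] /= e.
have {e}e : u = v by apply: functional_extensionality_dep.
by subst v; congr DSum; exact: Prop_irrelevance.
Qed.

Section DSumModule.
Context (k : fieldType) (V : int -> lmodType k).
Implicit Types u v w : dsum V.

HB.instance Definition _ := gen_eqMixin (dsum V).
HB.instance Definition _ := gen_choiceMixin (dsum V).

Lemma dsum_fin0 : finite_set [set i | (0 : V i) != 0].
Proof. by apply: sub_finite_set (finite_set0 int) => i /=; rewrite eqxx. Qed.
Definition dsum0 : dsum V := DSum dsum_fin0.

Lemma dsum_finN u : finite_set [set i | - u i != 0].
Proof. by apply: sub_finite_set (dval_fin u) => i /=; rewrite oppr_eq0. Qed.
Definition dsumN u : dsum V := DSum (dsum_finN u).

Lemma dsum_finD u v : finite_set [set i | u i + v i != 0].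
Proof.
apply: sub_finite_set (_ : finite_set
  ([set i | u i != 0] `|` [set i | v i != 0])) => [i /=|]; last first.
  by rewrite finite_setU; split; exact: dval_fin.
by case: (eqVneq (u i) 0) => [->|]; [rewrite add0r; right | left].
Qed.
Definition dsumD u v : dsum V := DSum (dsum_finD u v).

Lemma dsum_finZ (a : k) u : finite_set [set i | a *: u i != 0].
Proof.
apply: sub_finite_set (dval_fin u) => i /=.
by apply: contra_neq => ->; rewrite scaler0.
Qed.
Definition dsumZ a u : dsum V := DSum (dsum_finZ a u).

Fact dsum_addA : associative dsumD.
Proof. by move=> u v w; apply: dsumP => i /=; rewrite addrA. Qed.
Fact dsum_addC : commutative dsumD.
Proof. by move=> u v; apply: dsumP => i /=; rewrite addrC. Qed.
Fact dsum_add0 : left_id dsum0 dsumD.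
Proof. by move=> u; apply: dsumP => i /=; rewrite add0r. Qed.
Fact dsum_addN : left_inverse dsum0 dsumN dsumD.
Proof. by move=> u; apply: dsumP => i /=; rewrite addNr. Qed.
HB.instance Definition _ :=
  GRing.isZmodule.Build (dsum V) dsum_addA dsum_addC dsum_add0 dsum_addN.

Fact dsum_scaleA a b u : dsumZ a (dsumZ b u) = dsumZ (a * b) u.
Proof. by apply: dsumP => i /=; rewrite scalerA. Qed.
Fact dsum_scale1 : left_id 1 dsumZ.
Proof. by move=> u; apply: dsumP => i /=; rewrite scale1r. Qed.
Fact dsum_scaleDr : right_distributive dsumZ +%R.
Proof. by move=> a u v; apply: dsumP => i /=; rewrite scalerDr. Qed.
Fact dsum_scaleDl u : {morph dsumZ^~ u : a b / a + b}.
Proof. by move=> a b; apply: dsumP => i /=; rewrite scalerDl. Qed.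
HB.instance Definition _ := GRing.Zmodule_isLmodule.Build k (dsum V)
  dsum_scaleA dsum_scale1 dsum_scaleDr dsum_scaleDl.

Lemma dvalZD (a : k) u v i : (a *: u + v) i = a *: u i + v i.
Proof. by []. Qed.

Lemma dval0 i : (0 : dsum V) i = 0.
Proof. by []. Qed.

End DSumModule.

Lemma fsumE (W : nmodType) (F : int -> W) (r : seq int) : uniq r ->
  (forall i, i \notin r -> F i = 0) ->
  \sum_(i \in [set: int]) F i = \sum_(i <- r) F i.
Proof.
move=> ur hr; rewrite (fsbigE r) //.
- by apply: eq_bigl => i; rewrite in_setT.
- by move=> i _; exact: hr.
Qed.

Lemma fin_seq (P : int -> Prop) : finite_set [set i | P i] ->
  exists2 r : seq int, uniq r & forall i, i \notin r -> ~ P i.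
Proof.
move=> /finite_seqP [r er]; exists (undup r); first exact: undup_uniq.
move=> i; rewrite mem_undup => /negP ir Pi; apply: ir.
by have : [set i | P i] i by []; rewrite er.
Qed.

Lemma dsum_seq (k : fieldType) (V : int -> lmodType k) (u : dsum V) :
  exists2 r : seq int, uniq r & forall i, i \notin r -> u i = 0.
Proof.
have [r ur hr] := fin_seq (dval_fin u).
by exists r => // i /hr /negP; rewrite negbK => /eqP.
Qed.

Section DSumIn.
Context (k : fieldType) (V : int -> lmodType k) (a : int) (v : V a).

Definition dsumIn_fun (i : int) : V i :=
  if a =P i is ReflectT e then ecast i (V i) e v else 0.

Lemma dsumIn_funE : dsumIn_fun a = v.
Proof.
by rewrite /dsumIn_fun; case: eqP => // e; rewrite (Prop_irrelevance e erefl).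
Qed.

Lemma dsumIn_fun0 i : i != a -> dsumIn_fun i = 0.
Proof. by rewrite /dsumIn_fun eq_sym; case: eqP. Qed.

Lemma dsumIn_fin : finite_set [set i | dsumIn_fun i != 0].
Proof.
apply: sub_finite_set (finite_set1 a) => i /=.
by apply: contra_neqP => /eqP; exact: dsumIn_fun0.
Qed.

Definition dsumIn : dsum V := DSum dsumIn_fin.

End DSumIn.

Section Cast.
Context (k : fieldType) (C : linCat k).

Definition castd (x x' y : C) (e : x = x') (f : hom x y) : hom x' y :=
  ecast z (hom z y) e f.

Lemma arr_castd (x x' y : C) (e : x = x') (f : hom x y) :
  arr (castd e f) = arr f.
Proof. by case: x' / e. Qed.

Lemma castd_lin (x x' y : C) (e : x = x') : linear (@castd x x' y e).
Proof. by case: x' / e. Qed.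

End Cast.

Section Linearity.
Context (k : fieldType) (C : linCat k).

Lemma comp0m (x y z : C) (f : hom x y) : comp (0 : hom y z) f = 0.
Proof. by have := @comp_linl k C x y z f (-1) 0 0; rewrite !scaleN1r !addNr. Qed.

Lemma compm0 (x y z : C) (g : hom y z) : comp g (0 : hom x y) = 0.
Proof. by have := @comp_linr k C x y z g (-1) 0 0; rewrite !scaleN1r !addNr. Qed.

Lemma compDl (x y z : C) (f : hom x y) :
  {morph (fun g : hom y z => comp g f) : u v / u + v}.
Proof. by move=> u v; have := @comp_linl k C x y z f 1 u v; rewrite !scale1r. Qed.

Lemma compDr (x y z : C) (g : hom y z) :
  {morph (fun f : hom x y => comp g f) : u v / u + v}.
Proof. by move=> u v; have := @comp_linr k C x y z g 1 u v; rewrite !scale1r. Qed.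

Lemma castd0 (x x' y : C) (e : x = x') : castd e (0 : hom x y) = 0.
Proof. by case: x' / e. Qed.

Lemma castdD (x x' y : C) (e : x = x') : {morph @castd k C x x' y e : u v / u + v}.
Proof. by case: x' / e. Qed.

Lemma fmap0 (D : linCat k) (F : linFunctor C D) (x y : C) :
  fmap F (0 : hom x y) = 0.
Proof.
by have := @fmap_lin k C D F x y (-1) (0 : hom x y) 0; rewrite !scaleN1r !addNr.
Qed.

Lemma fmapD (D : linCat k) (F : linFunctor C D) (x y : C) :
  {morph @fmap k C D F x y : u v / u + v}.
Proof. by move=> u v; have := @fmap_lin k C D F x y 1 u v; rewrite !scale1r. Qed.

End Linearity.

Section Orbits.
Context (k : fieldType) (C : linCat k) (g : catIso C C).

Definition orbit (x : C) : set C := [set y | exists m : int, y = isoPow g m x].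

Definition orbits : Type := {O : set C | exists x, O = orbit x}.

Record orbitReps := OrbitReps {
  rep :> orbits -> C;
  repP : forall O : orbits, sval O (rep O)
}.

Lemma orbitReps_exist : inhabited orbitReps.
Proof.
have h (O : orbits) : {x : C | sval O x}.
  apply: cid; case: (svalP O) => x ->; exists x.
  by exists 0.
by constructor; exact: (OrbitReps (fun O => svalP (h O))).
Qed.

Lemma isoPow_sub (l m : int) (x : C) :
  isoPow g l (isoPow g (m - l) x) = isoPow g m x.
Proof.
have /(congr1 (fun F : linFunctor C C => F x)) /= := isoPowD g l (m - l).
by rewrite (addrC l) addrNK.
Qed.

(* The map hom (g^(m-l) x) y -> hom (g^m x) (g^l y) induced by g^l. *)
Definition powmap (l m : int) (x y : C) (f : hom (isoPow g (m - l) x) y) :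
  hom (isoPow g m x) (isoPow g l y) :=
  castd (isoPow_sub l m x) (fmap (isoPow g l) f).

Lemma powmap0 l m (x y : C) : powmap (0 : hom (isoPow g (m - l) x) y) = 0.
Proof. by rewrite /powmap fmap0 castd0. Qed.

Lemma powmap_lin l m (x y : C) : linear (@powmap l m x y).
Proof. by move=> a f f'; rewrite /powmap fmap_lin castd_lin. Qed.

Lemma powmapD l m (x y : C) : {morph @powmap l m x y : u v / u + v}.
Proof. by move=> u v; rewrite /powmap fmapD castdD. Qed.

Lemma arr_powmap l m (x y : C) (f : hom (isoPow g (m - l) x) y) :
  arr (powmap f) = arr (fmap (isoPow g l) f).
Proof. exact: arr_castd. Qed.

Lemma arr_pow2 j l (x y : C) (f : hom x y) :
  arr (fmap (isoPow g j) (fmap (isoPow g l) f)) = arr (fmap (isoPow g (j + l)) f).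
Proof.
exact: (congr1 (fun F : linFunctor C C => arr (fmap F f)) (isoPowD g j l)).
Qed.

Definition preOrbHom (x y : C) : lmodType k :=
  dsum (fun m : int => hom (isoPow g m x) y).

Section Comp.
Context (x y z : C).
Implicit Types (q : preOrbHom y z) (f : preOrbHom x y).

(* Degree m of (q_l)_l (f_k)_k is the sum of q_l g^l(f_k) over l + k = m. *)
Definition orbTerm q f m l : hom (isoPow g m x) z :=
  comp (q l) (powmap (f (m - l))).

Lemma orbTerm0l q f m l : q l = 0 -> orbTerm q f m l = 0.
Proof. by rewrite /orbTerm => ->; rewrite comp0m. Qed.

Lemma orbTerm0r q f m l : f (m - l) = 0 -> orbTerm q f m l = 0.
Proof. by rewrite /orbTerm => ->; rewrite powmap0 compm0. Qed.

Definition orbConv q f (m : int) : hom (isoPow g m x) z :=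
  \sum_(l \in [set: int]) orbTerm q f m l.

Lemma orbConvE q f m (r : seq int) : uniq r ->
  (forall i, i \notin r -> q i = 0) ->
  orbConv q f m = \sum_(l <- r) orbTerm q f m l.
Proof. by move=> ur hr; apply: fsumE => // i /hr; exact: orbTerm0l. Qed.

Lemma orbConv_supp q f (rq rf : seq int) : uniq rq ->
  (forall i, i \notin rq -> q i = 0) -> (forall i, i \notin rf -> f i = 0) ->
  forall m, m \notin [seq a + b | a <- rq, b <- rf] -> orbConv q f m = 0.
Proof.
move=> uq hq hf m mn; rewrite (orbConvE f m uq hq) big_seq big1 // => l lq.
apply/orbTerm0r/hf; apply: contra mn => mf.
by apply/allpairsP; exists (l, m - l); rewrite /= (addrC l) addrNK.
Qed.

Lemma orbConv_fin q f : finite_set [set m | orbConv q f m != 0].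
Proof.
have [rq uq hq] := dsum_seq q; have [rf uf hf] := dsum_seq f.
apply: sub_finite_set (finite_seq [seq a + b | a <- rq, b <- rf]) => m /=.
by apply: contra_neqT => /(orbConv_supp uq hq hf).
Qed.

Definition preOrbComp q f : preOrbHom x z := DSum (orbConv_fin q f).

End Comp.

Lemma preOrbComp_linl x y z (f : preOrbHom x y) :
  linear (fun q : preOrbHom y z => preOrbComp q f).
Proof.
move=> a q q'; apply: dsumP => m; rewrite dvalZD /=.
have [r ur hr] := dsum_seq q; have [r' ur' hr'] := dsum_seq q'.
have us : uniq (undup (r ++ r')) by exact: undup_uniq.
have [hs hs'] : (forall i, i \notin undup (r ++ r') -> q i = 0) /\
    (forall i, i \notin undup (r ++ r') -> q' i = 0).
  by split=> i; rewrite mem_undup mem_cat negb_or => /andP [/hr ? /hr' ?].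
rewrite !(orbConvE _ _ us) // => [|i ni]; last first.
  by rewrite dvalZD hs // hs' // scaler0 addr0.
by rewrite scaler_sumr -big_split; apply: eq_bigr => i _; rewrite /orbTerm dvalZD comp_linl.
Qed.

Lemma preOrbComp_linr x y z (q : preOrbHom y z) :
  linear (fun f : preOrbHom x y => preOrbComp q f).
Proof.
move=> a f f'; apply: dsumP => m; rewrite dvalZD /=.
have [r ur hr] := dsum_seq q; rewrite !(orbConvE _ _ ur) //.
rewrite scaler_sumr -big_split; apply: eq_bigr => i _.
by rewrite /orbTerm dvalZD powmap_lin comp_linr.
Qed.

Definition preOrbId (x : C) : preOrbHom x x :=
  dsumIn (V := fun m : int => hom (isoPow g m x) x) (a := 0) (idm x).

Lemma preOrbId0 x : preOrbId x 0 = idm x.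
Proof. exact: dsumIn_funE. Qed.

Lemma preOrbIdN x m : m != 0 -> preOrbId x m = 0.
Proof. exact: dsumIn_fun0. Qed.

Lemma dval_arr x y (f : preOrbHom x y) a b : a = b -> arr (f a) = arr (f b).
Proof. by move=> ->. Qed.

Lemma preOrb1m x y (f : preOrbHom x y) : preOrbComp (preOrbId y) f = f.
Proof.
apply: dsumP => m /=.
rewrite (@orbConvE _ _ _ _ _ m [:: 0]) // => [|i]; last first.
  by rewrite inE; exact: preOrbIdN.
rewrite big_seq1; apply: arr_inj; rewrite /orbTerm preOrbId0 [comp _ _]comp1m.
transitivity (arr (fmap (isoPow g 0) (f (m - 0)))); last first.
  by apply: (@dval_arr x y f); rewrite subr0.
exact: (@arr_powmap 0 m x y (f (m - 0))).
Qed.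

Lemma preOrbm1 x y (f : preOrbHom x y) : preOrbComp f (preOrbId x) = f.
Proof.
apply: dsumP => m /=.
rewrite /orbConv (@fsumE _ _ [:: m]) // => [|i]; last first.
  rewrite inE => ni; apply/orbTerm0r/preOrbIdN.
  by rewrite subr_eq0 eq_sym.
rewrite big_seq1 /orbTerm; apply: arr_inj.
rewrite -[in RHS](compm1 (f m)); apply: arr_comp => //.
rewrite arr_powmap -fmap1; apply: arr_fmap.
transitivity (arr (preOrbId x 0)); last by rewrite preOrbId0.
by apply: (@dval_arr x x (preOrbId x)); rewrite subrr.
Qed.

Lemma big_comp_linl x y z (f : hom x y) (r : seq int) (F : int -> @hom k C y z) :
  comp (\sum_(i <- r) F i) f = \sum_(i <- r) comp (F i) f.
Proof. exact: (big_morph (comp^~ f) (compDl f) (comp0m z f)). Qed.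

Lemma preOrbA x y z t (h : preOrbHom z t) (q : preOrbHom y z)
    (f : preOrbHom x y) :
  preOrbComp h (preOrbComp q f) = preOrbComp (preOrbComp h q) f.
Proof.
apply: dsumP => m /=.
have [rh uh hh] := dsum_seq h; have [rq uq hq] := dsum_seq q.
set L := undup [seq a + b | a <- rh, b <- rq].
have uL : uniq L by exact: undup_uniq.
have hL i : i \notin L -> preOrbComp h q i = 0.
  by rewrite mem_undup; exact: orbConv_supp.
rewrite (orbConvE _ _ uL hL) (orbConvE _ _ uh hh).
pose T l j : hom (isoPow g m x) t :=
  comp (orbTerm h q l j) (powmap (f (m - l))).
transitivity (\sum_(l <- L) \sum_(j <- rh) T l j); last first.
  apply: eq_bigr => l _; rewrite /orbTerm /= (orbConvE _ _ uh hh).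
  by rewrite big_comp_linl.
rewrite exchange_big /=; apply: eq_big_seq => j jh.
have T0 l : l \notin L -> T l j = 0.
  move=> nl; rewrite /T orbTerm0r ?comp0m //; apply: hq.
  apply: contra nl => lq; rewrite mem_undup; apply/allpairsP.
  by exists (j, l - j); rewrite /= (addrC j) addrNK.
rewrite -(fsumE uL T0) (@reindex_fsbigT _ _ _ _ _ (fun i : int => i + j)); last first.
  by exists (fun i => i - j) => i; rewrite ?addrK ?addrNK.
rewrite (@fsumE _ _ rq) // => [|i ni]; last first.
  by rewrite /T orbTerm0r ?comp0m // addrK hq.
rewrite /orbTerm [preOrbComp q f _](orbConvE _ _ uq hq).
rewrite (big_morph (@powmap j m x z) (@powmapD j m x z) (@powmap0 j m x z)).
rewrite (big_morph (comp (h j)) (compDr (h j)) (compm0 _ (h j))).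
apply: eq_bigr => i _; apply: arr_inj.
rewrite /T /orbTerm -compA; apply: arr_comp => //.
rewrite arr_powmap fmapM; apply: arr_comp.
  by rewrite arr_powmap; apply: arr_fmap; apply: dval_arr; rewrite addrK.
rewrite arr_powmap.
transitivity (arr (fmap (isoPow g j) (fmap (isoPow g i) (f (m - j - i))))).
  by apply: arr_fmap; rewrite arr_powmap.
rewrite arr_pow2.
have -> : m - j - i = m - (i + j) by rewrite opprD addrA addrAC.
by rewrite addrC.
Qed.

Definition orbLinCat (rp : orbitReps) : linCat k :=
  @LinCat k orbits
    (fun O P => preOrbHom (rp O) (rp P))
    (fun O => preOrbId (rp O))
    (fun O P Q q f => preOrbComp q f)
    (fun O P Q f => @preOrbComp_linl (rp O) (rp P) (rp Q) f)
    (fun O P Q q => @preOrbComp_linr (rp O) (rp P) (rp Q) q)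
    (fun O P f => preOrb1m f)
    (fun O P f => preOrbm1 f)
    (fun O P Q S h q f => preOrbA h q f).

Section Grading.
Context (rp : orbitReps).
Implicit Types (O P Q : orbLinCat rp).

Definition orbDeg O P (a : int) : set (hom O P) :=
  [set f : preOrbHom (rp O) (rp P) | forall m, m != a -> f m = 0].

Lemma dval_sum (V : int -> lmodType k) (r : seq int) (F : int -> dsum V) m :
  (\sum_(i <- r) F i) m = \sum_(i <- r) F i m.
Proof. exact: (big_morph (fun u : dsum V => u m) (fun _ _ => erefl) erefl). Qed.

Lemma orbDeg0 O P a : @orbDeg O P a 0.
Proof. by []. Qed.

Lemma orbDegP O P a c (f f' : hom O P) :
  orbDeg a f -> orbDeg a f' -> orbDeg a (c *: f + f').
Proof. by move=> hf hf' m ma; rewrite [LHS]dvalZD hf // hf' // scaler0 addr0. Qed.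

Lemma orbDeg_sum O P (f : hom O P) :
  exists2 u : int -> hom O P,
    finite_set [set a | u a != 0] /\ (forall a, orbDeg a (u a)) &
    f = \sum_(a \in [set: int]) u a.
Proof.
pose V m : lmodType k := hom (isoPow g m (rp O)) (rp P).
pose u a : hom O P := dsumIn (V := V) (a := a) ((f : dsum V) a).
have [r ur hr] := dsum_seq (f : dsum V).
have u0 a : a \notin r -> u a = 0.
  move=> ar; apply: dsumP => m /=; rewrite hr //.
  by rewrite /dsumIn_fun; case: eqP => // e; case: m / e.
exists u; [split|].
- apply: sub_finite_set (finite_seq r) => a /=.
  by apply: contra_neqT => /u0.
- by move=> a m; exact: dsumIn_fun0.
- rewrite (fsumE ur u0); apply: dsumP => m; rewrite dval_sum.
  case: (boolP (m \in r)) => mr; last first.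
    rewrite hr // big_seq big1 // => i ir; apply: dsumIn_fun0.
    by apply: contraNneq mr => ->.
  rewrite (bigD1_seq m) //= dsumIn_funE big1 ?addr0 // => i im.
  by apply: dsumIn_fun0; rewrite eq_sym.
Qed.

Lemma orbDeg_free O P (u : int -> hom O P) :
  finite_set [set a | u a != 0] -> (forall a, orbDeg a (u a)) ->
  \sum_(a \in [set: int]) u a = 0 -> forall a, u a = 0.
Proof.
move=> /fin_seq [r ur hr] hu s0 a; apply: dsumP => m.
have u0 i : i \notin r -> u i = 0 by move/hr/negP; rewrite negbK => /eqP.
have [->|/hu -> //] := eqVneq m a.
case: (boolP (a \in r)) => [ar|/u0 -> //].
move: s0; rewrite (fsumE ur u0) => /(congr1 (fun v : preOrbHom (rp O) (rp P) => v a)).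
rewrite dval_sum (bigD1_seq a) //= big1 ?addr0 // => i ia.
by apply: hu; rewrite eq_sym.
Qed.

Lemma orbDeg_comp O P Q a b (q : hom P Q) (f : hom O P) :
  orbDeg b q -> orbDeg a f -> orbDeg (b + a) (comp q f).
Proof.
move=> hq hf m mab /=; rewrite (@orbConvE _ _ _ _ _ m [:: b]) // => [|i]; last first.
  by rewrite inE; exact: hq.
rewrite big_seq1; apply/orbTerm0r/hf.
by apply: contra_neq mab => <-; rewrite (addrC b) addrNK.
Qed.

Definition orbitCat : grCat k :=
  GrCat orbDeg0 orbDegP orbDeg_sum orbDeg_free orbDeg_comp.

End Grading.
End Orbits.

Definition primitive_idempotent (k : fieldType) (A : falgType k) (e : A) : Prop :=
  [/\ e != 0, e * e = e &
      forall a b : A, a * a = a -> b * b = b -> a * b = 0 -> b * a = 0 ->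
        e = a + b -> a = 0 \/ b = 0].

Definition connected_algebra (k : fieldType) (A : falgType k) : Prop :=
  ~ exists (B C : falgType k) (f : {lrmorphism A -> (B * C)%type}), bijective f.

Definition right_ideal (k : fieldType) (A : falgType k) (e : A) : {vspace A} :=
  (<[e]> * {:A})%VS.

(* eA and fA are isomorphic as right A-modules. *)
Definition right_ideal_iso (k : fieldType) (A : falgType k) (e f : A) : Prop :=
  exists2 h : {linear subvs_of (right_ideal e) -> subvs_of (right_ideal f)},
    bijective h &
    forall (u v : subvs_of (right_ideal e)) (a : A),
      vsval v = vsval u * a -> vsval (h v) = vsval (h u) * a.

(* A basic connected finite-dimensional algebra over an algebraically closed
   field, with a fixed complete set of orthogonal primitive idempotents. *)
Record basicAlg (k : closedFieldType) := BasicAlg {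
  alg :> falgType k;
  alg_ob : finType;
  idem : alg_ob -> alg;
  idem_prim : forall x, primitive_idempotent (idem x);
  idem_orth : forall x y, x != y -> idem x * idem y = 0;
  idem_sum : \sum_x idem x = 1;
  alg_basic : forall x y, x != y -> ~ right_ideal_iso (idem x) (idem y);
  alg_connected : connected_algebra alg
}.
Arguments idem {k A} x : rename.

Section AlgCat.
Context (k : closedFieldType) (A : basicAlg k).
Implicit Types x y z w : alg_ob A.

Lemma idemK x : idem x * idem x = idem x.
Proof. by case: (idem_prim x). Qed.

(* A(x,y) = yAx *)
Definition corner x y : {vspace A} := (<[idem y]> * {:A} * <[idem x]>)%VS.

Definition Ahom x y : vectType k := subvs_of (corner x y).

Lemma cornerP x y (a : A) :
  reflect (idem y * a * idem x = a) (a \in corner x y).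
Proof.
apply: (iffP idP) => [|<-]; last by rewrite !memv_mul ?memv_line ?memvf.
have/subvP sub : (corner x y <= lker (amulr (idem x) \o amull (idem y) - \1)%VF)%VS.
  apply/prodvP => b c /[swap] /vlineP [t ->].
  have/subvP sub' : (<[idem y]> * {:A} <= lker (amull (idem y) - \1)%VF)%VS.
    apply/prodvP => b' c' /vlineP [s ->] _.
    rewrite memv_ker add_lfunE opp_lfunE id_lfunE lfunE /=.
    by rewrite -!scalerAl -scalerAr mulrA idemK subrr.
  move/sub'; rewrite !memv_ker !(add_lfunE, opp_lfunE, id_lfunE, comp_lfunE).
  rewrite !lfunE /= subr_eq0 => /eqP hb.
  by rewrite -!scalerAr -scalerAl mulrA hb -mulrA idemK subrr.
move/sub; rewrite memv_ker !(add_lfunE, opp_lfunE, id_lfunE, comp_lfunE).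
by rewrite !lfunE /= subr_eq0 => /eqP.
Qed.

Lemma Aidm_in x : idem x \in corner x x.
Proof. by apply/cornerP; rewrite !idemK. Qed.

Lemma Acomp_in x y z (g : Ahom y z) (f : Ahom x y) :
  vsval g * vsval f \in corner x z.
Proof.
have /cornerP hg := subvsP g; have /cornerP hf := subvsP f.
by apply/cornerP; rewrite -hg -hf !mulrA idemK -!mulrA idemK.
Qed.

Definition Aidm x : Ahom x x := Subvs (Aidm_in x).
Definition Acomp x y z (g : Ahom y z) (f : Ahom x y) : Ahom x z :=
  Subvs (Acomp_in g f).

Lemma Acomp_linl x y z (f : Ahom x y) : linear (fun g : Ahom y z => Acomp g f).
Proof. by move=> a g g'; apply: val_inj; rewrite /= mulrDl -scalerAl. Qed.

Lemma Acomp_linr x y z (g : Ahom y z) : linear (fun f : Ahom x y => Acomp g f).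
Proof. by move=> a f f'; apply: val_inj; rewrite /= mulrDr -scalerAr. Qed.

Lemma Acomp1m x y (f : Ahom x y) : Acomp (Aidm y) f = f.
Proof.
apply: val_inj => /=; have /cornerP {2}<- := subvsP f.
by have /cornerP {1}<- := subvsP f; rewrite !mulrA idemK.
Qed.

Lemma Acompm1 x y (f : Ahom x y) : Acomp f (Aidm x) = f.
Proof.
apply: val_inj => /=; have /cornerP {2}<- := subvsP f.
by have /cornerP {1}<- := subvsP f; rewrite -!mulrA idemK.
Qed.

Lemma AcompA x y z w (h : Ahom z w) (g : Ahom y z) (f : Ahom x y) :
  Acomp h (Acomp g f) = Acomp (Acomp h g) f.
Proof. by apply: val_inj; rewrite /= mulrA. Qed.

Definition algCat : linCat k :=
  @LinCat k (alg_ob A) Ahom Aidm Acomp Acomp_linl Acomp_linr Acomp1m Acompm1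
    AcompA.

(* A(x,x) consists of the scalar multiples of the identity of x. *)
Definition no_nonzero_oriented_cycles : Prop :=
  forall x, corner x x = <[idem x]>%VS.

(* D(A(y,x)), which consists of the morphisms from x^[i] to y^[i+1]. *)
Definition DAhom x y : vectType k := 'Hom(Ahom y x, k^o).

(* (b f)(u) = b(fu) *)
Definition dactr x y w (b : DAhom x y) (f : Ahom w x) : DAhom w y :=
  linfun (fun u : Ahom y w => b (Acomp f u)).

(* (f b)(u) = b(uf) *)
Definition dactl x y z (f : Ahom y z) (b : DAhom x y) : DAhom x z :=
  linfun (fun u : Ahom z x => b (Acomp u f)).

Lemma linfunE_lin (aT rT : vectType k) (f : aT -> rT) :
  linear f -> linfun f =1 f.
Proof.
move=> fl; pose f' : {linear aT -> rT} := HB.pack f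
  (GRing.isLinear.Build k aT rT *:%R f fl).
exact: (lfunE f').
Qed.

Lemma dactrE x y w (b : DAhom x y) (f : Ahom w x) u :
  dactr b f u = b (Acomp f u).
Proof. by apply: linfunE_lin => a v v'; rewrite Acomp_linr linearP. Qed.

Lemma dactlE x y z (f : Ahom y z) (b : DAhom x y) u :
  dactl f b u = b (Acomp u f).
Proof. by apply: linfunE_lin => a v v'; rewrite Acomp_linl linearP. Qed.

End AlgCat.

Section When.
Context (k : fieldType) (V : vectType k).

Definition when (b : bool) : vectType k :=
  subvs_of (if b then fullv else 0%VS : {vspace V}).

Definition whenIn (b : bool) (v : V) : when b := vsproj _ v.

Definition whenOut (b : bool) (v : when b) : V := vsval v.

Lemma whenInK (b : bool) (v : V) : (~~ b -> v = 0) -> whenOut (whenIn b v) = v.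
Proof.
case: b => v0; rewrite /whenOut /whenIn vsprojK ?memvf //.
by rewrite v0 // mem0v.
Qed.

Lemma whenOut0 (b : bool) (v : when b) : ~~ b -> whenOut v = 0.
Proof. by case: b v => // v _; apply/eqP; rewrite -memv0; exact: subvsP. Qed.

Lemma when_inj (b : bool) : injective (@whenOut b).
Proof. exact: val_inj. Qed.

End When.

Section Hat.
Context (k : closedFieldType) (A : basicAlg k).

Definition hatOb : Type := (alg_ob A * int)%type.
Implicit Types X Y Z W : hatOb.

(* The component A(x,y) is present between equal indices, and the component
   D(A(y,x)) from the index i to the index i+1. *)
Definition hatHom X Y : lmodType k :=
  (when (Ahom X.1 Y.1) (Y.2 == X.2)%R *
   when (DAhom X.1 Y.1) (Y.2 == X.2 + 1)%R)%type.

Definition hatMk X Y (f : Ahom X.1 Y.1) (b : DAhom X.1 Y.1) : hatHom X Y :=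
  (whenIn _ f, whenIn _ b).

Definition hatA X Y (f : hatHom X Y) : Ahom X.1 Y.1 := whenOut f.1.
Definition hatD X Y (f : hatHom X Y) : DAhom X.1 Y.1 := whenOut f.2.

Definition hatIdm X : hatHom X X := hatMk (Aidm X.1) 0.

Definition hatComp X Y Z (g : hatHom Y Z) (f : hatHom X Y) : hatHom X Z :=
  hatMk (Acomp (hatA g) (hatA f))
        (dactr (hatD g) (hatA f) + dactl (hatA g) (hatD f)).

Lemma hat_eq X Y (f g : hatHom X Y) : hatA f = hatA g -> hatD f = hatD g -> f = g.
Proof. by case: f g => [f b] [g c] /when_inj /= -> /when_inj /= ->. Qed.

Lemma hatA0 X Y (f : hatHom X Y) : Y.2 != X.2 -> hatA f = 0.
Proof. exact: whenOut0. Qed.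

Lemma hatD0 X Y (f : hatHom X Y) : Y.2 != X.2 + 1 -> hatD f = 0.
Proof. exact: whenOut0. Qed.

Lemma hatA_Mk X Y (f : Ahom X.1 Y.1) b :
  (Y.2 != X.2 -> f = 0) -> hatA (@hatMk X Y f b) = f.
Proof. exact: whenInK. Qed.

Lemma hatD_Mk X Y (f : Ahom X.1 Y.1) b :
  (Y.2 != X.2 + 1 -> b = 0) -> hatD (@hatMk X Y f b) = b.
Proof. exact: whenInK. Qed.

Lemma hatA_lin X Y : linear (@hatA X Y).
Proof. by []. Qed.

Lemma hatD_lin X Y : linear (@hatD X Y).
Proof. by []. Qed.

Lemma Acomp0l x y z (f : Ahom (A := A) x y) : Acomp (0 : Ahom y z) f = 0.
Proof. exact: (@comp0m k (algCat A)). Qed.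
Lemma Acomp0r x y z (g : Ahom (A := A) y z) : Acomp g (0 : Ahom x y) = 0.
Proof. exact: (@compm0 k (algCat A)). Qed.

Lemma dactr0l x y w (f : Ahom (A := A) w x) : dactr (0 : DAhom x y) f = 0.
Proof. by apply/lfunP => u; rewrite dactrE !lfunE. Qed.
Lemma dactr0r x y w (b : DAhom (A := A) x y) : dactr b (0 : Ahom w x) = 0.
Proof. by apply/lfunP => u; rewrite dactrE Acomp0l linear0 lfunE. Qed.
Lemma dactl0l x y z (b : DAhom (A := A) x y) : dactl (0 : Ahom y z) b = 0.
Proof. by apply/lfunP => u; rewrite dactlE Acomp0r linear0 lfunE. Qed.
Lemma dactl0r x y z (f : Ahom (A := A) y z) : dactl f (0 : DAhom x y) = 0.
Proof. by apply/lfunP => u; rewrite dactlE !lfunE. Qed.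

Lemma hatA_comp X Y Z (g : hatHom Y Z) (f : hatHom X Y) :
  hatA (hatComp g f) = Acomp (hatA g) (hatA f).
Proof.
apply: hatA_Mk => ne; have [e|/hatA0 ->] := eqVneq Y.2 X.2; last exact: Acomp0r.
by rewrite hatA0 ?Acomp0l // e.
Qed.

Lemma hatD_comp X Y Z (g : hatHom Y Z) (f : hatHom X Y) :
  hatD (hatComp g f) = dactr (hatD g) (hatA f) + dactl (hatA g) (hatD f).
Proof.
apply: hatD_Mk => ne.
have -> : dactr (hatD g) (hatA f) = 0.
  have [e|/hatA0 ->] := eqVneq Y.2 X.2; last exact: dactr0r.
  by rewrite hatD0 ?dactr0l // e.
have [e|/hatD0 ->] := eqVneq Y.2 (X.2 + 1); last by rewrite dactl0r addr0.
by rewrite hatA0 ?dactl0l ?addr0 // e.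
Qed.

Lemma hatA_idm X : hatA (hatIdm X) = Aidm X.1.
Proof. by apply: hatA_Mk; rewrite eqxx. Qed.

Lemma hatD_idm X : hatD (hatIdm X) = 0.
Proof. exact: hatD_Mk. Qed.

Lemma hatComp_linl X Y Z (f : hatHom X Y) :
  linear (fun g : hatHom Y Z => hatComp g f).
Proof.
move=> a g g'; apply: hat_eq.
  by rewrite hatA_lin !hatA_comp hatA_lin Acomp_linl.
rewrite hatD_lin !hatD_comp hatA_lin hatD_lin; apply/lfunP => u.
rewrite !(add_lfunE, scale_lfunE, dactrE, dactlE) Acomp_linr linearP.
by rewrite scalerDr addrACA.
Qed.

Lemma hatComp_linr X Y Z (g : hatHom Y Z) :
  linear (fun f : hatHom X Y => hatComp g f).
Proof.
move=> a f f'; apply: hat_eq.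
  by rewrite hatA_lin !hatA_comp hatA_lin Acomp_linr.
rewrite hatD_lin !hatD_comp hatA_lin hatD_lin; apply/lfunP => u.
rewrite !(add_lfunE, scale_lfunE, dactrE, dactlE) Acomp_linl linearP.
by rewrite scalerDr addrACA.
Qed.

Lemma hatComp1m X Y (f : hatHom X Y) : hatComp (hatIdm Y) f = f.
Proof.
apply: hat_eq; first by rewrite hatA_comp hatA_idm Acomp1m.
rewrite hatD_comp hatD_idm hatA_idm dactr0l add0r; apply/lfunP => u.
by rewrite dactlE Acompm1.
Qed.

Lemma hatCompm1 X Y (f : hatHom X Y) : hatComp f (hatIdm X) = f.
Proof.
apply: hat_eq; first by rewrite hatA_comp hatA_idm Acompm1.
rewrite hatD_comp hatD_idm hatA_idm dactl0r addr0; apply/lfunP => u.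
by rewrite dactrE Acomp1m.
Qed.

Lemma hatCompA X Y Z W (h : hatHom Z W) (g : hatHom Y Z) (f : hatHom X Y) :
  hatComp h (hatComp g f) = hatComp (hatComp h g) f.
Proof.
apply: hat_eq; first by rewrite !hatA_comp AcompA.
rewrite !hatD_comp !hatA_comp; apply/lfunP => u.
by rewrite !(add_lfunE, dactrE, dactlE) !AcompA addrA.
Qed.

Definition hat : linCat k :=
  @LinCat k hatOb hatHom hatIdm hatComp hatComp_linl hatComp_linr
    hatComp1m hatCompm1 hatCompA.

(* Two arrows of the repetitive category with the same components are equal,
   although their indices may be only propositionally equal. *)
Lemma hat_arr (x y : alg_ob A) (i j i' j' : int) (f : hatHom (x, i) (y, j))
    (f' : hatHom (x, i') (y, j')) : i = i' -> j = j' ->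
  hatA f = hatA f' -> hatD f = hatD f' ->
  arr (f : @hom k hat _ _) = arr (f' : @hom k hat _ _).
Proof. by move=> ei ej; subst => eA eD; rewrite (hat_eq eA eD). Qed.

Section Shift.
Context (s : int).
Definition shiftOb X : hatOb := (X.1, X.2 + s).
Definition shiftHom X Y (f : hatHom X Y) : hatHom (shiftOb X) (shiftOb Y) :=
  @hatMk (shiftOb X) (shiftOb Y) (hatA f) (hatD f).

Lemma hatA_shift X Y (f : hatHom X Y) : hatA (shiftHom f) = hatA f.
Proof.
by apply: hatA_Mk => /= ne; apply: hatA0; apply: contra_neq ne => ->.
Qed.

Lemma hatD_shift X Y (f : hatHom X Y) : hatD (shiftHom f) = hatD f.
Proof.
apply: hatD_Mk => /= ne; apply: hatD0; apply: contra_neq ne => ->.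
by rewrite addrAC.
Qed.

Definition hatShift : linFunctor hat hat.
Proof.
refine (@LinFunctor k hat hat shiftOb shiftHom _ _ _).
- move=> X Y a f g; apply: hat_eq.
    by rewrite hatA_lin !hatA_shift hatA_lin.
  by rewrite hatD_lin !hatD_shift hatD_lin.
- move=> X; apply: hat_eq; first by rewrite hatA_shift !hatA_idm.
  by rewrite hatD_shift !hatD_idm.
- move=> X Y Z g f; apply: hat_eq.
    by rewrite hatA_comp !hatA_shift hatA_comp.
  by rewrite hatD_comp !hatD_shift !hatA_shift hatD_comp.
Defined.
End Shift.

Lemma hatShiftD (s t : int) : s + t = 0 ->
  fcomp (hatShift s) (hatShift t) = fid hat.
Proof.
move=> st; apply: functor_eq => -[x i] [y j] f.
apply: (@hat_arr x y (i + t + s) (j + t + s) i j).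
- by rewrite -addrA (addrC t) st addr0.
- by rewrite -addrA (addrC t) st addr0.
- exact: etrans (hatA_shift s (shiftHom t f)) (hatA_shift t f).
- exact: etrans (hatD_shift s (shiftHom t f)) (hatD_shift t f).
Qed.

Definition nakayama : catIso hat hat :=
  CatIso (hatShiftD (addNr 1)) (hatShiftD (addrN 1)).

(* id^[i], viewed as a functor from A to the whole repetitive category. *)
Section Embed.
Context (i : int).
Definition embHom x y (f : Ahom (A := A) x y) : hatHom (x, i) (y, i) :=
  @hatMk (x, i) (y, i) f 0.

Lemma hatA_emb x y (f : Ahom (A := A) x y) : hatA (embHom f) = f.
Proof. by apply: hatA_Mk; rewrite /= eqxx. Qed.

Lemma hatD_emb x y (f : Ahom (A := A) x y) : hatD (embHom f) = 0.
Proof. exact: hatD_Mk. Qed.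

Definition hatEmb : linFunctor (algCat A) hat.
Proof.
refine (@LinFunctor k (algCat A) hat (fun x => (x, i)) embHom _ _ _).
- move=> x y a f g; apply: hat_eq; first by rewrite hatA_lin !hatA_emb.
  by rewrite hatD_lin !hatD_emb scaler0 addr0.
- by [].
- move=> x y z g f; apply: hat_eq; first by rewrite hatA_comp !hatA_emb.
  by rewrite hatD_comp !hatD_emb !hatA_emb dactr0l dactl0r addr0.
Defined.
End Embed.

(* The objects of A^[i]. As A^[i] and its images under automorphisms are full
   subcategories, phi(A^[0]) = A^[n] is an equality of sets of objects. *)
Definition level (i : int) : set hat := [set X : hatOb | X.2 = i].

Definition has_jump (phi : catIso hat hat) (n : int) : Prop :=
  [set phi X | X in level 0] = level n.

(* sigma = (id^[0])^-1 phi nu^-n id^[0]; as id^[0] is injective, at most one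
   functor sigma satisfies this. *)
Definition is_zero_part (phi : catIso hat hat) (n : int)
    (sigma : linFunctor (algCat A) (algCat A)) : Prop :=
  fcomp (hatEmb 0) sigma =
  fcomp (fcomp phi (isoPow nakayama (- n))) (hatEmb 0).

Section HatFunctor.
Context (sigma : catIso (algCat A) (algCat A)).

Definition fmapA x y (f : Ahom (A := A) x y) : Ahom (sigma x) (sigma y) :=
  fmap sigma f.

Definition hatfOb X : hatOb := (sigma X.1, X.2).

(* b is sent to b \o (sigma|_{A(y,x)})^-1 *)
Definition hatfD x y (b : DAhom (A := A) x y) : DAhom (sigma x) (sigma y) :=
  (b \o (linfun (@fmapA y x))^-1)%VF.

Definition hatfHom X Y (f : hatHom X Y) : hatHom (hatfOb X) (hatfOb Y) :=
  @hatMk (hatfOb X) (hatfOb Y) (fmapA (hatA f)) (hatfD (hatD f)).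

Lemma fmapA_lin x y : linear (@fmapA x y).
Proof. exact: (@fmap_lin _ _ _ sigma). Qed.

Lemma fmapA_bij x y : bijective (@fmapA x y).
Proof.
have e : forall x y (f : @hom k (algCat A) x y),
    arr (fmap (isoV sigma) (fmap sigma f)) = arr f.
  by move=> u v f; exact: (congr1 (fun F : linFunctor (algCat A) (algCat A) =>
    arr (fmap F f)) (isoVK sigma)).
have e' : forall x y (f : @hom k (algCat A) x y),
    arr (fmap sigma (fmap (isoV sigma) f)) = arr f.
  by move=> u v f; exact: (congr1 (fun F : linFunctor (algCat A) (algCat A) =>
    arr (fmap F f)) (isoK sigma)).
have ob u : isoV sigma (sigma u) = u.
  exact: (congr1 (fun F : linFunctor (algCat A) (algCat A) => F u) (isoVK sigma)).
have fI : injective (@fmapA x y).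
  move=> f f' ff'; apply: (@arr_inj k (algCat A)).
  by rewrite -[LHS]e -[RHS]e; congr (arr (fmap _ _)).
have fS (h : Ahom (sigma x) (sigma y)) : exists f : Ahom x y, fmapA f = h.
  have : exists f : Ahom x y, arr (f : @hom k (algCat A) x y) =
      arr (fmap (isoV sigma) (h : @hom k (algCat A) (sigma x) (sigma y))).
    move: (fmap (isoV sigma) _) => h'; move: h'; rewrite !ob => h'.
    by exists h'.
  case=> f fE; exists f; apply: (@arr_inj k (algCat A)).
  by rewrite -[RHS]e'; apply: arr_fmap.
pose G h := sval (cid (fS h)).
have GK : cancel G (@fmapA x y) by move=> h; exact: (svalP (cid (fS h))).
by exists G => // f; apply: fI; rewrite GK.
Qed.

Lemma linfun_fmapAE x y : linfun (@fmapA x y) =1 @fmapA x y.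
Proof. exact/linfunE_lin/fmapA_lin. Qed.

Lemma fmapA_VK x y : cancel (linfun (@fmapA x y)) (linfun (@fmapA x y))^-1%VF.
Proof.
apply: lker0_lfunK; apply/lker0P => f f'; rewrite !linfun_fmapAE.
exact: (bij_inj (fmapA_bij x y)).
Qed.

Lemma hatfDE x y (b : DAhom (A := A) x y) (u : Ahom y x) :
  hatfD b (fmapA u) = b u.
Proof. by rewrite comp_lfunE -linfun_fmapAE fmapA_VK. Qed.

Lemma hatfD_eq x y (b : DAhom (A := A) x y) (c : DAhom (sigma x) (sigma y)) :
  (forall u, c (fmapA u) = b u) -> hatfD b = c.
Proof.
move=> h; apply/lfunP => u; have [G _ GK] := fmapA_bij y x.
by rewrite -(GK u) hatfDE h.
Qed.

Lemma fmapA0 x y : fmapA (0 : Ahom x y) = 0.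
Proof. exact: (@fmap0 k _ _ sigma). Qed.

Lemma hatfD0 x y : hatfD (0 : DAhom x y) = 0.
Proof. by apply: hatfD_eq => u; rewrite !lfunE. Qed.

Lemma hatA_f X Y (f : hatHom X Y) : hatA (hatfHom f) = fmapA (hatA f).
Proof. by apply: hatA_Mk => /= /hatA0 ->; rewrite fmapA0. Qed.

Lemma hatD_f X Y (f : hatHom X Y) : hatD (hatfHom f) = hatfD (hatD f).
Proof. by apply: hatD_Mk => /= /hatD0 ->; rewrite hatfD0. Qed.

Definition hatFun : linFunctor hat hat.
Proof.
refine (@LinFunctor k hat hat hatfOb hatfHom _ _ _).
- move=> X Y a f g; apply: hat_eq.
    by rewrite hatA_lin !hatA_f hatA_lin fmapA_lin.
  rewrite hatD_lin !hatD_f hatD_lin; apply: hatfD_eq => u.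
  by rewrite !(add_lfunE, scale_lfunE) !hatfDE.
- move=> X; apply: hat_eq.
    by rewrite hatA_f !hatA_idm; exact: (fmap1 sigma).
  by rewrite hatD_f !hatD_idm hatfD0.
- have fM x y z (g : Ahom y z) (f : Ahom x y) :
      fmapA (Acomp g f) = Acomp (fmapA g) (fmapA f) by exact: (fmapM sigma).
  move=> X Y Z g f; apply: hat_eq.
    by rewrite hatA_comp !hatA_f hatA_comp fM.
  rewrite hatD_comp !hatD_f !hatA_f hatD_comp; apply: hatfD_eq => u.
  by rewrite !(add_lfunE, dactrE, dactlE) -!fM !hatfDE.
Defined.

End HatFunctor.

Lemma hatFun_comp (s t : catIso (algCat A) (algCat A)) :
  fcomp (hatFun s) (hatFun t) = hatFun (isoComp s t).
Proof.
apply: functor_eq => -[x i] [y j] f; apply: hat_arr => //.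
  transitivity (fmapA s (hatA (hatfHom t f))); first exact: (hatA_f s).
  by rewrite (hatA_f t); exact/esym/(hatA_f (isoComp s t)).
transitivity (hatfD s (hatD (hatfHom t f))); first exact: (hatD_f s).
rewrite (hatD_f t); transitivity (hatfD (isoComp s t) (hatD f)); last first.
  exact/esym/(hatD_f (isoComp s t)).
apply/esym; apply: (@hatfD_eq (isoComp s t)) => u.
exact: etrans (hatfDE s (hatfD t (hatD f)) (fmapA t u)) (hatfDE t (hatD f) u).
Qed.

Lemma hatFun_eq (s t : catIso (algCat A) (algCat A)) :
  s = t :> linFunctor _ _ -> hatFun s = hatFun t.
Proof.
case: s t => [F G e1 e2] [F' G' e1' e2'] /= e; subst F'.
by apply: functor_eq.
Qed.

Lemma hatFun1 : hatFun (iso1 (algCat A)) = fid hat.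
Proof.
apply: functor_eq => -[x i] [y j] f; apply: hat_arr => //.
  exact: (hatA_f (iso1 (algCat A))).
transitivity (hatfD (iso1 (algCat A)) (hatD f)).
  exact: (hatD_f (iso1 (algCat A))).
exact: (@hatfD_eq (iso1 (algCat A))).
Qed.

Definition hatIso (sigma : catIso (algCat A) (algCat A)) : catIso hat hat.
Proof.
refine (@CatIso k hat hat (hatFun sigma) (hatFun (isoInv sigma)) _ _).
- by rewrite hatFun_comp -hatFun1; apply: hatFun_eq; rewrite /= isoVK.
- by rewrite hatFun_comp -hatFun1; apply: hatFun_eq; rewrite /= isoK.
Defined.

(* The automorphism whose orbit category is the twisted n-fold extension. *)
Definition twist (sigma : catIso (algCat A) (algCat A)) (n : int) :
  catIso hat hat := isoComp (hatIso sigma) (isoPow nakayama n).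

Definition twistedExt (sigma : catIso (algCat A) (algCat A)) (n : int)
  (rp : orbitReps (twist sigma n)) : grCat k := orbitCat rp.

End Hat.

(* Main.v *)
From HB Require Import structures.
From mathcomp Require Import all_boot all_algebra all_field.
From mathcomp Require Import boolp classical_sets cardinality fsbigop.
From mathcomp Require Import ring.
Require Import Defs.

Set Implicit Arguments.
Unset Strict Implicit.
Unset Printing Implicit Defensive.

Import GRing.Theory.
Local Open Scope ring_scope.

(** Write H for the repetitive category of A, nu for its Nakayama automorphism
    and psi for the twist of phi0 by nu^n. The point is that phi and psi have
    the same values on objects and differ on morphisms only by scalars: there
    are nonzero d(X), one for each object, with
    d(X) phi(f) = d(Y) psi(f) for every f : X -> Y. In other words the scalars
    d are the components of a natural isomorphism from psi to phi, and
    naturally isomorphic automorphisms have isomorphic graded orbit categories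
    ([orbitCat_iso]).

    To find d, compose phi nu^-n with the inverse of the extension of phi0 to
    H. This gives an automorphism e that is the identity on level 0. The
    category H carries a duality: composition
    hom(Y, nu X) x hom(X, Y) -> hom(X, nu X) followed by evaluation at the
    identity of X is a nondegenerate pairing ([hatTr_nondegl],
    [hatTr_nondegr]). As A(x,x) = k, the space hom(X, nu X) is a line, so an
    automorphism fixing all objects acts on it by a scalar c(X). Through the
    pairing, the action on hom(X, Y) determines the one on hom(Y, nu X) up to
    c(X), and conversely. Starting from the identity on level 0 and walking up
    and down the levels, one finds that e acts on hom(X, Y) by d(Y) / d(X),
    where d = 1 on level 0 and d(nu X) = c(X) d(X) ([inner_scalars]).

    The same duality shows that every automorphism of H commutes with nu on
    objects ([iso_nakayama_ob]), because nu X is recognized up to isomorphism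
    by the pairing, and isomorphic objects of H are equal as A is basic
    ([hat_loop_eq]). Hence phi raises every level by n, not only level 0; this
    gives the existence of phi0 ([zero_part_exists]), and it shows that e fixes
    all objects. *)

(** * Integer-indexed recursion *)

Lemma int_shift_ind (P : int -> Prop) :
  P 0 -> (forall i, P i <-> P (i + 1)) -> forall i, P i.
Proof.
move=> P0 PS; elim=> [//|m Pm|m Pm].
  by rewrite -addn1 PoszD; apply/(PS m)/Pm.
by apply/(PS _); rewrite -addn1 PoszD opprD addrNK.
Qed.

(** A recursion over all integers needs nonzero factors: below 0 it divides by
    them. *)
Lemma int_mul_rec (k : fieldType) (c : int -> k) : (forall i, c i != 0) ->
  exists D : int -> k,
    [/\ D 0 = 1, forall i, D (i + 1) = c i * D i & forall i, D i != 0].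
Proof.
move=> c0; pose D i := match i with
  | Posz m => \prod_(j < m) c (Posz j)
  | Negz m => (\prod_(j < m.+1) c (Negz j))^-1 end.
have DP (m : nat) : D m = \prod_(j < m) c (Posz j) by [].
have DN m : D (Negz m) = (\prod_(j < m.+1) c (Negz j))^-1 by [].
exists D; split; first by rewrite DP big_ord0.
  case=> [m|[|m]].
  - by rewrite -PoszD addn1 !DP big_ord_recr mulrC.
  - by rewrite (_ : Negz 0 + 1 = 0%N) // DP DN big_ord0 big_ord1 divff.
  - rewrite (_ : Negz m.+1 + 1 = Negz m); last first.
      by rewrite !NegzE -addn1 PoszD opprD addrNK.
    by rewrite !DN [in RHS]big_ord_recr invfM mulrC mulrVK ?unitfE.
by case=> m; rewrite ?DP ?DN ?invr_eq0; apply/prodf_neq0.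
Qed.

(** * Arrows, casts and isomorphisms of categories *)

Section Arrows.
Context (k : fieldType) (C : linCat k).

Lemma arr_lin (a : k) (x y x' y' : C) (f g : hom x y) (f' g' : hom x' y') :
  arr f = arr f' -> arr g = arr g' -> arr (a *: f + g) = arr (a *: f' + g').
Proof.
by move=> ef eg; have [ex ey] := arr_ob ef; subst; rewrite (arr_inj ef) (arr_inj eg).
Qed.

Lemma arr_scale (a : k) (x y x' y' : C) (f : hom x y) (f' : hom x' y') :
  arr f = arr f' -> arr (a *: f) = arr (a *: f').
Proof. by move=> ef; have [ex ey] := arr_ob ef; subst; rewrite (arr_inj ef). Qed.

Lemma arr_scaleI (a : k) (x y x' y' : C) (f : hom x y) (f' : hom x' y') :
  a != 0 -> arr (a *: f) = arr (a *: f') -> arr f = arr f'.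
Proof.
move=> a0 /(arr_scale a^-1); rewrite !scalerA mulVf //.
by rewrite !scale1r.
Qed.

Lemma arr0 (x y x' y' : C) : x = x' -> y = y' ->
  arr (0 : hom x y) = arr (0 : hom x' y').
Proof. by move=> -> ->. Qed.

Definition cast2 (x x' y y' : C) (ex : x = x') (ey : y = y') (f : hom x y) :
  hom x' y' := castd ex (ecast z (hom x z) ey f).

Lemma arr_cast2 (x x' y y' : C) (ex : x = x') (ey : y = y') (f : hom x y) :
  arr (cast2 ex ey f) = arr f.
Proof. by case: x' / ex; case: y' / ey. Qed.

Lemma cast2_lin (x x' y y' : C) (ex : x = x') (ey : y = y') :
  linear (cast2 ex ey).
Proof. by case: x' / ex; case: y' / ey. Qed.

Lemma fmapZ (D : linCat k) (F : linFunctor C D) (a : k) (x y : C) (f : hom x y) :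
  fmap F (a *: f) = a *: fmap F f.
Proof. by rewrite -[a *: f]addr0 fmap_lin fmap0 addr0. Qed.

Lemma compZl (a : k) (x y z : C) (g : hom y z) (f : hom x y) :
  comp (a *: g) f = a *: comp g f.
Proof. by rewrite -[a *: g]addr0 comp_linl comp0m addr0. Qed.

Lemma compZr (a : k) (x y z : C) (g : hom y z) (f : hom x y) :
  comp g (a *: f) = a *: comp g f.
Proof. by rewrite -[a *: f]addr0 comp_linr compm0 addr0. Qed.

Lemma compBl (x y z : C) (g h : hom y z) (f : hom x y) :
  comp (g - h) f = comp g f - comp h f.
Proof. by rewrite compDl -scaleN1r compZl scaleN1r. Qed.

Lemma compBr (x y z : C) (h : hom y z) (f g : hom x y) :
  comp h (f - g) = comp h f - comp h g.
Proof. by rewrite compDr -scaleN1r compZr scaleN1r. Qed.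

End Arrows.

Section Isomorphisms.
Context (k : fieldType) (C D : linCat k).

Lemma isoVKa (F : catIso C D) (x y : C) (f : hom x y) :
  arr (fmap (isoV F) (fmap F f)) = arr f.
Proof. exact: (congr1 (fun G : linFunctor C C => arr (fmap G f)) (isoVK F)). Qed.

Lemma isoKa (F : catIso C D) (x y : D) (f : hom x y) :
  arr (fmap F (fmap (isoV F) f)) = arr f.
Proof. exact: (congr1 (fun G : linFunctor D D => arr (fmap G f)) (isoK F)). Qed.

Lemma isoV_ob (F : catIso C D) (x : C) : isoV F (F x) = x.
Proof. exact: (congr1 (fun G : linFunctor C C => G x) (isoVK F)). Qed.

Lemma iso_ob (F : catIso C D) (x : D) : F (isoV F x) = x.
Proof. exact: (congr1 (fun G : linFunctor D D => G x) (isoK F)). Qed.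

Lemma iso_arrI (F : catIso C D) (x y x' y' : C) (f : hom x y) (f' : hom x' y') :
  arr (fmap F f) = arr (fmap F f') -> arr f = arr f'.
Proof. by move/(arr_fmap (isoV F)); rewrite !isoVKa. Qed.

Lemma iso_inj (F : catIso C D) (x y : C) : injective (@fmap k C D F x y).
Proof. by move=> f f' e; apply/arr_inj/(@iso_arrI F); rewrite e. Qed.

Lemma iso_fmap_eq0 (F : catIso C D) (x y : C) (f : hom x y) :
  (fmap F f == 0) = (f == 0).
Proof. by rewrite -(inj_eq (@iso_inj F x y)) fmap0. Qed.

Lemma iso_full (F : catIso C D) (x y : C) (h : hom (F x) (F y)) :
  exists f : hom x y, fmap F f = h.
Proof.
exists (cast2 (isoV_ob F x) (isoV_ob F y) (fmap (isoV F) h)).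
by apply: arr_inj; rewrite -[RHS](isoKa F); apply: arr_fmap; exact: arr_cast2.
Qed.

(** The inverse functor has to be chosen on morphisms whose endpoints agree with
    the required ones only propositionally; comparing arrows instead of
    morphisms keeps casts out of the functor laws. *)
Lemma catIso_of_bij (F : linFunctor C D) (G : D -> C) :
  cancel F G -> cancel G F ->
  (forall x y, injective (@fmap k C D F x y)) ->
  (forall x y (h : hom (F x) (F y)), exists f : hom x y, fmap F f = h) ->
  exists H : catIso C D, H = F :> linFunctor C D.
Proof.
move=> FK GK Finj Ffull.
have FaI (x y x' y' : C) (f : hom x y) (f' : hom x' y') :
    arr (fmap F f) = arr (fmap F f') -> arr f = arr f'.
  move=> e; have [ex ey] := arr_ob e.
  have {}ex := can_inj FK ex; have {}ey := can_inj FK ey; subst.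
  by rewrite (Finj _ _ _ _ (arr_inj e)).
have lift (u v : D) (h : hom u v) :
    {f : hom (G u) (G v) | arr (fmap F f) = arr h}.
  apply: cid; have [f fh] := Ffull _ _ (cast2 (esym (GK u)) (esym (GK v)) h).
  by exists f; rewrite fh arr_cast2.
pose m u v (h : hom u v) := sval (lift u v h).
have mP u v (h : hom u v) : arr (fmap F (m u v h)) = arr h := svalP (lift u v h).
have m_lin u v : linear (@m u v).
  move=> a h h'; apply: arr_inj; apply: FaI.
  by rewrite mP fmap_lin; apply: arr_lin; rewrite mP.
have m1 u : m u u (idm u) = idm (G u).
  by apply: arr_inj; apply: FaI; rewrite mP fmap1 GK.
have mM u v w (h' : hom v w) (h : hom u v) :
    m u w (comp h' h) = comp (m v w h') (m u v h).
  apply: arr_inj; apply: FaI.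
  by rewrite mP fmapM; apply: arr_comp; rewrite mP.
pose V := LinFunctor m_lin m1 mM.
have VK : fcomp V F = fid C.
  by apply: functor_eq => x y f; apply: FaI; exact: mP.
have KV : fcomp F V = fid D by apply: functor_eq => u v h; exact: mP.
by exists (CatIso VK KV).
Qed.

End Isomorphisms.

(** * Orbit categories of isomorphic automorphisms *)

Section OrbitIso.
Context (k : fieldType) (C : linCat k) (g g' : catIso C C) (d : C -> k).
Hypothesis d_neq0 : forall x, d x != 0.
Hypothesis gg' : forall (x y : C) (f : hom x y),
  arr (d x *: fmap g f) = arr (d y *: fmap g' f).

Lemma rescaled_ob x : g x = g' x.
Proof. by have [] := arr_ob (gg' (idm x)). Qed.

Lemma isoPowS_ob (h : catIso C C) m x : isoPow h (m + 1) x = h (isoPow h m x).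
Proof. by rewrite isoPowS. Qed.

Lemma isoPowD_ob (h : catIso C C) m n x :
  isoPow h m (isoPow h n x) = isoPow h (m + n) x.
Proof. by rewrite -(isoPowD h). Qed.

Lemma isoPowS_arr (h : catIso C C) m x y (f : hom x y) :
  arr (fmap (isoPow h (m + 1)) f) = arr (fmap h (fmap (isoPow h m) f)).
Proof. by rewrite isoPowS. Qed.

Lemma rescaled_pow_ob m x : isoPow g m x = isoPow g' m x.
Proof.
elim/int_shift_ind: m => // m; rewrite !isoPowS_ob -rescaled_ob.
by split=> [-> //|]; apply: (can_inj (isoV_ob g)).
Qed.

(** The natural isomorphism between g and g' induces one between their m-th
    powers. Its component D m x multiplies the factors d along the g-orbit of x,
    which is what the cocycle identity says. *)
Lemma rescaled_pow : exists D : int -> C -> k,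
  [/\ forall x, D 0 x = 1, forall m x, D m x != 0,
      forall l m x, D (l + m) x = D l (isoPow g m x) * D m x &
      forall m x y (f : hom x y),
        arr (D m x *: fmap (isoPow g m) f) = arr (D m y *: fmap (isoPow g' m) f)].
Proof.
have h x := cid (int_mul_rec (fun m => d_neq0 (isoPow g m x))).
pose D m x := sval (h x) m.
have D0 x : D 0 x = 1 by rewrite /D; case: (h x) => ? [].
have DS m x : D (m + 1) x = d (isoPow g m x) * D m x.
  by rewrite /D; case: (h x) => ? [].
have Dn0 m x : D m x != 0 by rewrite /D; case: (h x) => ? [].
exists D; split=> // [l m x|m x y f].
  elim/int_shift_ind: l => [|l]; first by rewrite D0 mul1r add0r.
  rewrite addrAC !DS isoPowD_ob -mulrA.
  by split=> [-> //|]; apply: mulfI.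
elim/int_shift_ind: m => [|m]; first by rewrite !D0.
have L : arr (D (m + 1) x *: fmap (isoPow g (m + 1)) f) =
    arr (d (isoPow g m x) *: fmap g (D m x *: fmap (isoPow g m) f)).
  by rewrite DS -scalerA fmapZ; do 2 apply: arr_scale; exact: isoPowS_arr.
have R : arr (D (m + 1) y *: fmap (isoPow g' (m + 1)) f) =
    arr (d (isoPow g m x) *: fmap g (D m y *: fmap (isoPow g' m) f)).
  transitivity (arr (d (isoPow g m y) *: fmap g' (D m y *: fmap (isoPow g' m) f))).
    by rewrite DS -scalerA fmapZ; do 2 apply: arr_scale; exact: isoPowS_arr.
  by rewrite !rescaled_pow_ob gg'.
rewrite L R; split=> [e|/(arr_scaleI (d_neq0 _)) /iso_arrI //].
by apply: arr_scale; apply: arr_fmap.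
Qed.

Lemma orbit_rescaled x : orbit g x = orbit g' x.
Proof.
apply/seteqP; split=> y [m ->]; exists m; first exact: rescaled_pow_ob.
exact/esym/rescaled_pow_ob.
Qed.

Definition orbTo (O : orbits g) : orbits g'.
Proof.
exists (sval O); case: (svalP O) => x ->; exists x; exact: orbit_rescaled.
Defined.

Definition orbFrom (O : orbits g') : orbits g.
Proof.
exists (sval O); case: (svalP O) => x ->; exists x; exact/esym/orbit_rescaled.
Defined.

Lemma orbToK : cancel orbTo orbFrom.
Proof. by case=> O hO; apply: eq_exist. Qed.

Lemma orbFromK : cancel orbFrom orbTo.
Proof. by case=> O hO; apply: eq_exist. Qed.

Section Representatives.
Context (r : orbitReps g) (r' : orbitReps g').

Lemma rep_shift : exists t : orbits g -> int,
  forall O, r' (orbTo O) = isoPow g' (t O) (r O).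
Proof.
suff h O : exists n, r' (orbTo O) = isoPow g' n (r O).
  by exists (fun O => sval (cid (h O))) => O; exact: svalP (cid (h O)).
have := repP r' (orbTo O); have := repP r O; rewrite /=.
case: (svalP O) => x ->; rewrite orbit_rescaled => -[a ->] [b ->].
by exists (b - a); rewrite isoPowD_ob subrK.
Qed.

Context (D : int -> C -> k) (t : orbits g -> int).
Hypothesis D0 : forall x, D 0 x = 1.
Hypothesis D_neq0 : forall m x, D m x != 0.
Hypothesis D_cocycle : forall l m x, D (l + m) x = D l (isoPow g m x) * D m x.
Hypothesis D_rescaled : forall m x y (f : hom x y),
  arr (D m x *: fmap (isoPow g m) f) = arr (D m y *: fmap (isoPow g' m) f).
Hypothesis tP : forall O, r' (orbTo O) = isoPow g' (t O) (r O).

Implicit Types O P Q : orbits g.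

(** A morphism from g^a (r O) to r P is carried to a morphism between the new
    representatives by applying g'^(t P); a power of g' is peeled off its source
    to reach the representative r' of O, so that degree a becomes
    a + t P - t O. The scalar D a makes up for trading the powers of g in the
    orbit category for powers of g'. *)
Lemma shiftAt_dom O P m :
  isoPow g' (t P) (isoPow g (m + t O - t P) (r O)) = isoPow g' m (r' (orbTo O)).
Proof. by rewrite rescaled_pow_ob tP !isoPowD_ob [in LHS]addrC subrK. Qed.

Definition shiftAt O P m (u : hom (isoPow g (m + t O - t P) (r O)) (r P)) :
    hom (isoPow g' m (r' (orbTo O))) (r' (orbTo P)) :=
  D (m + t O - t P) (r O) *:
    cast2 (shiftAt_dom O P m) (esym (tP P)) (fmap (isoPow g' (t P)) u).

Lemma arr_shiftAt O P m n (u : hom (isoPow g (m + t O - t P) (r O)) (r P))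
    (v : hom (isoPow g n (r O)) (r P)) :
  n = m + t O - t P -> arr u = arr v ->
  arr (shiftAt u) = arr (D n (r O) *: fmap (isoPow g' (t P)) v).
Proof.
move=> en euv; subst n; apply: arr_scale.
by rewrite arr_cast2; apply: arr_fmap.
Qed.

Lemma shiftAt_lin O P m : linear (@shiftAt O P m).
Proof.
move=> a u v; rewrite /shiftAt fmap_lin cast2_lin scalerDr.
by rewrite !scalerA mulrC.
Qed.

Lemma shiftAt0 O P m : @shiftAt O P m 0 = 0.
Proof. by have := @shiftAt_lin O P m (-1) 0 0; rewrite !scaleN1r !addNr. Qed.

Lemma shiftAtD O P m : {morph @shiftAt O P m : u v / u + v}.
Proof. by move=> u v; have := @shiftAt_lin O P m 1 u v; rewrite !scale1r. Qed.

Lemma transport_fin O P (f : preOrbHom g (r O) (r P)) :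
  finite_set [set m | shiftAt (f (m + t O - t P)) != 0]%classic.
Proof.
have [s _ hs] := dsum_seq f.
apply: sub_finite_set (finite_seq [seq i + t P - t O | i <- s]) => m /=.
apply: contra_neqT => ms; rewrite hs ?shiftAt0 //; apply: contra ms => ms.
by apply/mapP; exists (m + t O - t P); rewrite ?subrK ?addrK.
Qed.

Definition transport O P (f : preOrbHom g (r O) (r P)) :
  preOrbHom g' (r' (orbTo O)) (r' (orbTo P)) := DSum (transport_fin f).

Lemma transport_lin O P : linear (@transport O P).
Proof.
by move=> a f f'; apply: dsumP => m; rewrite dvalZD; exact: shiftAt_lin.
Qed.

Lemma transport1 O : transport (preOrbId g (r O)) = preOrbId g' (r' (orbTo O)).
Proof.
apply: dsumP => m; have [->|m0] := eqVneq m 0; last first.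
  rewrite [RHS]preOrbIdN //; apply: etrans (shiftAt0 O O m).
  by congr shiftAt; apply: preOrbIdN; rewrite addrK.
apply: arr_inj; rewrite [in RHS]preOrbId0 /=.
rewrite (@arr_shiftAt O O 0 0 _ (idm (r O))); last 2 first.
- by rewrite addrK.
- transitivity (arr (preOrbId g (r O) 0)); last by rewrite preOrbId0.
  by apply: (@dval_arr _ _ g _ _ (preOrbId g (r O))); rewrite addrK.
by rewrite D0 scale1r fmap1 tP.
Qed.

(** In both composites the term indexed by the degree l of q is a scalar times
    g'^(t Q) (q l g^l (f_(M-l))). The scalars agree by the cocycle identity
    for D, and trading g^l for g'^l costs exactly D l. *)
Lemma transportM O P Q (q : preOrbHom g (r P) (r Q)) (f : preOrbHom g (r O) (r P)) :
  transport (preOrbComp q f) = preOrbComp (transport q) (transport f).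
Proof.
apply: dsumP => m /=; set M := m + t O - t Q.
have [s us hs] := dsum_seq q.
rewrite (orbConvE _ _ us hs).
rewrite (big_morph (@shiftAt O Q m) (@shiftAtD O Q m) (@shiftAt0 O Q m)).
(* transport q moves degree l of q to degree l + t Q - t P *)
rewrite /orbConv (@reindex_fsbigT _ _ _ _ _ (fun l : int => l + t Q - t P)); last first.
  by exists (fun i => i + t P - t Q) => i; rewrite ?subrK ?addrK ?subrK ?addrK.
have ix l : l + t Q - t P + t P - t Q = l by rewrite subrK addrK.
rewrite (@fsumE _ _ s) // => [|l ls]; last first.
  have q0 : q (l + t Q - t P + t P - t Q) = 0 by apply: hs; rewrite ix.
  by rewrite /orbTerm /= q0 shiftAt0 comp0m.
apply: eq_bigr => l _; apply: arr_inj.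
rewrite (@arr_shiftAt O Q m M _ _ erefl erefl) /orbTerm /=.
set l' := l + t Q - t P; set fl := f (M - l).
have ix' : M - l = m - l' + t O - t P by rewrite /M /l'; ring.
have eD : D (l' + t P - t Q) (r P) = D l (r P) by rewrite ix.
rewrite fmapM -compZr {1}/shiftAt eD compZl -compZr.
apply: arr_comp.
  by rewrite arr_cast2; apply: arr_fmap; apply: (@dval_arr _ _ g _ _ q); exact/esym/ix.
have -> : D M (r O) = D (M - l) (r O) * D l (isoPow g (M - l) (r O)).
  by rewrite mulrC -D_cocycle [l + _]addrC subrK.
rewrite -scalerA -fmapZ.
transitivity (arr (D (M - l) (r O) *: fmap (isoPow g' (t Q))
    (D l (r P) *: fmap (isoPow g' l) fl))).
  apply: arr_scale; apply: arr_fmap; rewrite -D_rescaled; apply: arr_scale.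
  exact: arr_powmap.
rewrite fmapZ !scalerA mulrC -scalerA; apply: arr_scale.
have -> : arr (powmap (shiftAt (f (m - l' + t O - t P)))) =
    arr (fmap (isoPow g' l') (D (M - l) (r O) *: fmap (isoPow g' (t P)) fl)).
  rewrite arr_powmap; apply: arr_fmap; apply: arr_shiftAt => //.
  exact: (@dval_arr _ _ g _ _ f).
rewrite fmapZ; apply: arr_scale; rewrite !arr_pow2.
by congr (arr (fmap (isoPow g' _) fl)); rewrite /l'; ring.
Qed.

Lemma transport_inj O P : injective (@transport O P).
Proof.
move=> f f' e; apply: dsumP => n.
have [m ->] : exists m, n = m + t O - t P.
  by exists (n + t P - t O); rewrite subrK addrK.
apply/arr_inj; apply: (@iso_arrI _ _ _ (isoPow g' (t P))).
apply: (arr_scaleI (D_neq0 (m + t O - t P) (r O))).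
rewrite -!(@arr_shiftAt O P m _ _ _ erefl erefl); congr arr.
exact: (congr1 (fun h : preOrbHom g' _ _ => h m) e).
Qed.

Lemma transport_surj O P
    (h : preOrbHom g' (r' (orbTo O)) (r' (orbTo P))) :
  exists f, @transport O P f = h.
Proof.
have ed n : isoPow g' (n + t P - t O) (r' (orbTo O)) =
    isoPow g' (t P) (isoPow g n (r O)).
  by rewrite rescaled_pow_ob tP !isoPowD_ob subrK addrC.
have lift n : {u : hom (isoPow g n (r O)) (r P) |
    arr (D n (r O) *: fmap (isoPow g' (t P)) u) = arr (h (n + t P - t O))}.
  apply: cid; have [u uh] := iso_full (cast2 (ed n) (tP P) (h (n + t P - t O))).
  exists ((D n (r O))^-1 *: u).
  by rewrite fmapZ scalerA divff // scale1r uh arr_cast2.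
pose f n := sval (lift n); have fP n := svalP (lift n).
have f_fin : finite_set [set n | f n != 0]%classic.
  have [s _ hs] := dsum_seq h.
  apply: sub_finite_set (finite_seq [seq i + t O - t P | i <- s]) => n /=.
  apply: contra_neqT => ns; apply: (@iso_inj _ _ _ (isoPow g' (t P))).
  apply: (scalerI (D_neq0 n (r O))); apply: arr_inj.
  rewrite fP fmap0 scaler0 hs; last first.
    by apply: contra ns => ns; apply/mapP; eexists; [exact: ns | ring].
  exact: arr0.
exists (DSum f_fin); apply: dsumP => m; apply: arr_inj.
rewrite [LHS](@arr_shiftAt O P m _ _ _ erefl erefl) [LHS]fP.
by apply: (@dval_arr _ _ g' _ _ h); ring.
Qed.

Definition orbFunctor : linFunctor (orbitCat r) (orbitCat r') :=
  @LinFunctor k (orbitCat r) (orbitCat r') orbTo transport transport_lin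
    transport1 transportM.

Lemma orbFunctor_degree : degree_preserving orbFunctor.
Proof.
(* the degree moves by t P - t O, hence the sign *)
exists (fun O => - t O) => O P a _ [f fa <-] m ma /=.
have z : f (m + t O - t P) = 0.
  apply: fa; apply: contra_neq ma => e.
  by rewrite -[LHS](addrK (t O)) -[m + _](subrK (t P)) e /=; ring.
by rewrite z shiftAt0.
Qed.

End Representatives.

(** Two independent choices are reconciled at once: the shift t compares the
    representatives, at the price of moving degrees, and the scalars D compare
    the powers of g and g'. *)
Lemma orbitCat_iso (r : orbitReps g) (r' : orbitReps g') :
  gr_isomorphic (orbitCat r) (orbitCat r').
Proof.
have [D [D0 Dn0 Dc Dresc]] := rescaled_pow; have [t tP] := rep_shift r r'.
pose F := orbFunctor D0 Dc Dresc tP.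
have [H HF] := @catIso_of_bij _ _ _ F orbFrom orbToK orbFromK
  (fun O P => @transport_inj r r' D t Dn0 tP O P)
  (fun O P => @transport_surj r r' D t Dn0 tP O P).
by exists H; rewrite HF; exact: orbFunctor_degree.
Qed.

End OrbitIso.

Lemma dual_separates (k : closedFieldType) (V : vectType k) (v : V) :
  v != 0 -> exists b : 'Hom(V, k^o), b v != 0.
Proof.
move=> v0; pose X := [tuple v]; have X_free : free X by rewrite seq1_free.
have co_lin : linear (coord X ord0 : V -> k^o) by move=> a u w; rewrite linearP.
exists (linfun (coord X ord0 : V -> k^o)); rewrite [X in X != _](linfunE_lin co_lin).
by rewrite (@coord_free _ _ _ X ord0 ord0 X_free) oner_neq0.
Qed.

(** * The duality of the repetitive category *)

Section Hat.
Context (k : closedFieldType) (A : basicAlg k).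
Hypothesis acyclic : no_nonzero_oriented_cycles A.
Local Notation H := (hat A).
Local Notation nu := (nakayama A).
Implicit Types X Y Z : H.

(** Evaluation at the identity: the trace form that makes the repetitive
    category a category with Serre functor nu. *)
Definition hatTr X (h : hom X (nu X)) : k := hatD h (Aidm X.1).

(** The two summands pair A(x,y) with its dual, in either order; this is why
    the trace form is nondegenerate on both sides. *)
Lemma hatTr_comp X Y (g : hom Y (nu X)) (f : hom X Y) :
  hatTr (comp g f) = hatD g (hatA f) + hatD f (hatA g).
Proof.
rewrite /hatTr [hatD (comp g f)]hatD_comp add_lfunE dactrE dactlE.
by congr (_ + _); [congr (hatD g _); exact: Acompm1 | congr (hatD f _); exact: Acomp1m].
Qed.

Lemma hatTr0 X : hatTr (0 : hom X (nu X)) = 0.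
Proof. by rewrite /hatTr [hatD _]linear0 lfunE. Qed.

Lemma hat_neq0 X Y (f : hom X Y) :
  f != 0 -> (Y.2 = X.2 /\ hatA f != 0) \/ (Y.2 = X.2 + 1 /\ hatD f != 0).
Proof.
move=> f0; have [A0|] := eqVneq (hatA f) 0; last first.
  move=> fA; left; split=> //; apply/eqP; apply: contraNT fA => ne.
  by rewrite hatA0.
have [D0|] := eqVneq (hatD f) 0; last first.
  move=> fD; right; split=> //; apply/eqP; apply: contraNT fD => ne.
  by rewrite hatD0.
by case/eqP: f0; apply: hat_eq.
Qed.

Lemma hatTr_nondegl X Y (f : hom X Y) :
  f != 0 -> exists g : hom Y (nu X), hatTr (comp g f) != 0.
Proof.
case/hat_neq0=> -[e f0].
  have [b bf] := dual_separates f0.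
  exists (@hatMk k A Y (nu X) 0 b); rewrite hatTr_comp hatA_Mk //.
  by rewrite hatD_Mk ?linear0 ?addr0 //= e eqxx.
have [u fu] : exists u, hatD f u != 0.
  apply: contrapT => h; case/eqP: f0; apply/lfunP => u; rewrite lfunE.
  by apply/eqP; apply: contra_notT h => ?; exists u.
exists (@hatMk k A Y (nu X) u 0); rewrite hatTr_comp hatD_Mk // lfunE add0r.
by rewrite hatA_Mk //= e eqxx.
Qed.

Lemma hatTr_nondegr X Y (g : hom Y (nu X)) :
  g != 0 -> exists f : hom X Y, hatTr (comp g f) != 0.
Proof.
case/hat_neq0=> -[e g0].
  have [b bg] := dual_separates g0.
  exists (@hatMk k A X Y 0 b); rewrite hatTr_comp hatA_Mk //.
  by rewrite hatD_Mk ?linear0 ?add0r //= -e eqxx.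
have [u gu] : exists u, hatD g u != 0.
  apply: contrapT => h; case/eqP: g0; apply/lfunP => u; rewrite lfunE.
  by apply/eqP; apply: contra_notT h => ?; exists u.
exists (@hatMk k A X Y u 0); rewrite hatTr_comp hatD_Mk // lfunE addr0.
by rewrite hatA_Mk //= (addIr _ e) eqxx.
Qed.

Lemma comp_nondegl X Y (f : hom X Y) :
  (forall g : hom Y (nu X), comp g f = 0) -> f = 0.
Proof.
move=> h; apply: contrapT => /eqP /hatTr_nondegl [g].
by rewrite h hatTr0 eqxx.
Qed.

Lemma comp_nondegr X Y (g : hom Y (nu X)) :
  (forall f : hom X Y, comp g f = 0) -> g = 0.
Proof.
move=> h; apply: contrapT => /eqP /hatTr_nondegr [f].
by rewrite h hatTr0 eqxx.
Qed.

Lemma Aend_scalar x (a : Ahom (A := A) x x) : exists c : k, a = c *: Aidm x.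
Proof.
have /vlineP [c e] : vsval a \in <[idem x]>%VS by rewrite -acyclic; exact: subvsP.
by exists c; apply: val_inj; rewrite /= e.
Qed.

Lemma idem_neq0 (x : alg_ob A) : idem x != 0.
Proof. by case: (idem_prim x). Qed.

(** Since A(x,x) = k, its dual is a line. The generator w spans the socle of the
    projective at nu X. *)
Lemma soc_exists X : exists2 w : hom X (nu X), w != 0 &
  forall h : hom X (nu X), exists c : k, h = c *: w.
Proof.
have i0 : Aidm X.1 != 0 by rewrite -(inj_eq val_inj) /=; exact: idem_neq0.
have [b bi] := dual_separates i0.
pose w : hom X (nu X) := @hatMk k A X (nu X) 0 b.
have wD : hatD w = b by apply: hatD_Mk => /=; rewrite eqxx.
exists w.
  apply: contra_neq bi => w0; rewrite -wD w0.
  by rewrite [hatD _]linear0 lfunE.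
move=> h; exists (hatD h (Aidm X.1) / b (Aidm X.1)).
have ne : (nu X).2 != X.2 by rewrite /= -[X in _ != X]addr0 (inj_eq (addrI _)).
apply: hat_eq; first by rewrite !hatA0.
apply/lfunP => u; have [c ->] := Aend_scalar u.
set a := _ / _; have -> : hatD (a *: w) = a *: b by rewrite -wD.
rewrite scale_lfunE !linearZ /=; congr (_ *: _).
by rewrite /a [RHS]mulrVK // unitfE.
Qed.

End Hat.

(** * The repetitive category is basic *)

Section RightIdeals.
Context (k : closedFieldType) (A : basicAlg k).
Implicit Types x y : alg_ob A.

Lemma right_ideal_idem x (u : A) : u \in right_ideal (idem x) -> idem x * u = u.
Proof.
move=> uI; suff /subvP/(_ u uI) :
    (right_ideal (idem x) <= lker (amull (idem x) - \1)%VF)%VS.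
  rewrite memv_ker add_lfunE opp_lfunE id_lfunE lfunE /= subr_eq0.
  by move/eqP.
apply/prodvP => b c /vlineP [s ->] _.
rewrite memv_ker add_lfunE opp_lfunE id_lfunE lfunE /=.
by rewrite -!scalerAl -scalerAr mulrA idemK subrr.
Qed.

Lemma mem_right_ideal x (u : A) : idem x * u = u -> u \in right_ideal (idem x).
Proof. by move=> <-; rewrite memv_mul ?memv_line ?memvf. Qed.

(** Left multiplication by a morphism is a map of right modules. *)
Lemma right_ideal_iso_of_inv x y (a : Ahom x y) (b : Ahom y x) :
  Acomp b a = Aidm x -> Acomp a b = Aidm y ->
  right_ideal_iso (idem x) (idem y).
Proof.
move=> /(congr1 vsval) /= ba /(congr1 vsval) /= ab.
have memM (z w : alg_ob A) (c : Ahom z w) (u : A) : vsval c * u \in right_ideal (idem w).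
  by apply: mem_right_ideal; have /cornerP <- := subvsP c; rewrite !mulrA idemK.
pose h (z w : alg_ob A) (c : Ahom z w) (u : subvs_of (right_ideal (idem z))) :
  subvs_of (right_ideal (idem w)) := Subvs (memM z w c (vsval u)).
have h_lin z w c : linear (@h z w c).
  by move=> s u v; apply: val_inj; rewrite /= mulrDr scalerAr.
pose h' : {linear _ -> _} := HB.pack (h x y a)
  (GRing.isLinear.Build k _ _ *:%R (h x y a) (h_lin x y a)).
exists h'.
  exists (h y x b) => u; apply: val_inj; rewrite /= mulrA ?ba ?ab.
    by apply: right_ideal_idem; exact: subvsP.
  by apply: right_ideal_idem; exact: subvsP.
by move=> u v c e; rewrite /= e mulrA.
Qed.

End RightIdeals.

Section Nakayama.
Context (k : closedFieldType) (A : basicAlg k).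
Hypothesis acyclic : no_nonzero_oriented_cycles A.
Local Notation H := (hat A).
Local Notation nu := (nakayama A).

(** Endomorphisms are scalars, so a nonzero b a is an invertible scalar c.
    Evaluating b a b a in two ways shows that a b is the same scalar, hence
    a and c^-1 b are mutually inverse, and A is basic. *)
Lemma Aloop_eq x y (a : Ahom (A := A) x y) (b : Ahom (A := A) y x) :
  Acomp b a != 0 -> x = y.
Proof.
have [c ba] := Aend_scalar acyclic (Acomp b a).
have [c' ab] := Aend_scalar acyclic (Acomp a b).
rewrite ba => ci0; have c0 : c != 0.
  by apply: contra_neq ci0 => ->; rewrite scale0r.
have cc' : c' = c.
  have e : Acomp b (Acomp (Acomp a b) a) = Acomp (Acomp b a) (Acomp b a).
    by rewrite !AcompA.
  move: e; rewrite ab ba.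
  have Zl z w t s (g : Ahom (A := A) w t) (f : Ahom z w) :
      Acomp (s *: g) f = s *: Acomp g f by exact: (@compZl _ (algCat A)).
  have Zr z w t s (g : Ahom (A := A) w t) (f : Ahom z w) :
      Acomp g (s *: f) = s *: Acomp g f by exact: (@compZr _ (algCat A)).
  rewrite Zl Zr Acomp1m ba Zl Zr Acomp1m => e.
  have {}e : (c' * c - c * c) *: Aidm x = 0.
    by rewrite scalerBl -!scalerA e subrr.
  move/eqP: e; rewrite scaler_eq0 -mulrBl mulf_eq0 subr_eq0 (negPf c0) orbF.
  by case/orP => [/eqP //|/eqP i0]; case/eqP: ci0; rewrite i0 scaler0.
apply: contrapT => /eqP xy; apply: (alg_basic xy).
apply: (@right_ideal_iso_of_inv _ _ _ _ a (c^-1 *: b)).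
  rewrite [Acomp _ _](@compZl _ (algCat A)).
  by apply: etrans (congr1 (fun f => c^-1 *: f) ba) _; rewrite scalerA mulVf // scale1r.
rewrite [Acomp _ _](@compZr _ (algCat A)).
by apply: etrans (congr1 (fun f => c^-1 *: f) ab) _; rewrite cc' scalerA mulVf // scale1r.
Qed.

Lemma hat_loop_eq (P Q : H) (u : hom P Q) (v : hom Q P) : comp v u != 0 -> P = Q.
Proof.
(* a loop has no component that raises the index *)
case/hat_neq0 => -[e vu0]; last first.
  by move/eqP: e; rewrite -[X in X == _]addr0 (inj_eq (addrI _)).
move: vu0; rewrite [hatA _]hatA_comp => vu0.
have PQ1 : P.1 = Q.1 := Aloop_eq vu0.
have [QP2|ne] := eqVneq Q.2 P.2.
  by case: P Q PQ1 QP2 {u v e vu0} => ? ? [? ?] /= -> ->.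
by move: vu0; rewrite (hatA0 u ne) Acomp0r eqxx.
Qed.

(** Nondegeneracy at phi X, applied to phi w for a socle generator w at X, gives
    g' : phi (nu X) -> nu (phi X) with g' (phi w) nonzero. Nondegeneracy at X,
    transported by phi, gives a morphism back that does not annihilate the
    socle generator at phi X, of which g' (phi w) is a nonzero multiple. So the
    two objects are linked by a nonzero loop. *)
Lemma iso_nakayama_ob (phi : catIso H H) X : phi (nu X) = nu (phi X).
Proof.
have [w w0 _] := soc_exists acyclic X.
have [w' w'0 w'P] := soc_exists acyclic (phi X).
have pw0 : fmap phi w != 0 by rewrite iso_fmap_eq0.
have [g' /negP g'w] : exists g' : hom (phi (nu X)) (nu (phi X)),
    comp g' (fmap phi w) != 0.
  have [g' gw] := hatTr_nondegl pw0; exists g'.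
  by apply: contra_neq gw => ->; exact: hatTr0.
have [c g'wE] := w'P (comp g' (fmap phi w)).
have c0 : c != 0 by apply/negP => /eqP c0; apply: g'w; rewrite g'wE c0 scale0r.
(* write nu (phi X) as phi of an object, so that w' comes from a morphism *)
move: (nu (phi X)) (iso_ob phi (nu (phi X))) w' w'0 g' g'wE {g'w w'P}.
move=> Q <- w' w'0 g' g'wE.
have [f fE] := iso_full w'.
have f0 : f != 0 by rewrite -(iso_fmap_eq0 phi) fE.
have [g gf] := hatTr_nondegl f0.
apply: (@hat_loop_eq _ _ g' (fmap phi g)).
apply: contra_neq gf => gg'.
have : comp (fmap phi g) (comp g' (fmap phi w)) = 0 by rewrite compA gg' comp0m.
rewrite g'wE compZr -fE -fmapM => /eqP; rewrite scaler_eq0 (negPf c0) /= => /eqP z.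
have gf0 : comp g f = 0 by apply: (@iso_inj _ _ _ phi); rewrite fmap0.
exact: etrans (congr1 (@hatTr k A X) gf0) (hatTr0 X).
Qed.

(** * Automorphisms that are the identity on level 0 *)

Section Inner.
(* The morphism part of a faithful endofunctor fixing all objects, taken apart
   from the functor so that no endpoint has to be cast. *)
Context (m : forall X Y : H, hom X Y -> hom X Y).
Hypothesis m_lin : forall X Y, linear (@m X Y).
Hypothesis m_inj : forall X Y (f : hom X Y), m f = 0 -> f = 0.
Hypothesis mM : forall X Y Z (g : hom Y Z) (f : hom X Y),
  m (comp g f) = comp (m g) (m f).
Hypothesis m_level0 : forall x y (f : hom ((x, 0) : H) (y, 0)), m f = f.

Lemma inner0 X Y : m (0 : hom X Y) = 0.
Proof. by have := @m_lin X Y (-1) 0 0; rewrite !scaleN1r !addNr. Qed.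

Lemma soc_scalar X : exists2 c : k, c != 0 & forall h : hom X (nu X), m h = c *: h.
Proof.
have mZ Y Z a (f : hom Y Z) : m (a *: f) = a *: m f.
  by have := @m_lin Y Z a f 0; rewrite inner0 !addr0.
have [w w0 wP] := soc_exists acyclic X.
have [c mw] := wP (m w); exists c.
  by apply: contra_neq w0 => c0; apply: m_inj; rewrite mw c0 scale0r.
by move=> h; have [a ->] := wP h; rewrite mZ mw !scalerA mulrC.
Qed.

(** By nondegeneracy, the identity d(X) m(f) = d(Y) f for all f : X -> Y is
    equivalent to the corresponding one for all morphisms Y -> nu X. Two such
    steps lead from hom(X, Y) to hom(nu X, nu Y), so everything follows from
    level 0. *)
Lemma inner_scalars : exists2 d : H -> k, forall X, d X != 0 &
  forall X Y (f : hom X Y), d X *: m f = d Y *: f.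
Proof.
have hc X : {c : k | c != 0 /\ forall h : hom X (nu X), m h = c *: h}.
  by apply: cid; have [c c0 ch] := soc_scalar X; exists c.
pose c X := sval (hc X); have c0 X : c X != 0 := proj1 (svalP (hc X)).
have cP X (h : hom X (nu X)) : m h = c X *: h := proj2 (svalP (hc X)) h.
have hd x := cid (int_mul_rec (fun i => c0 (x, i))).
pose d (X : H) : k := sval (hd X.1) X.2.
have d0 x : d (x, 0) = 1 by rewrite /d; case: (hd _) => ? [].
have dS X : d (nu X) = c X * d X.
  by case: X => x i; rewrite /d /=; case: (hd _) => ? [].
have dn0 X : d X != 0 by rewrite /d; case: (hd _) => ? [].
exists d => //.
pose good X Y := forall f : hom X Y, d X *: m f = d Y *: f.
have step X Y : good X Y <-> good Y (nu X).
  (* both sides are d X * d Y times m (g f) = c X *: g f *)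
  have e (g : hom Y (nu X)) (f : hom X Y) :
      comp (d Y *: m g) (d X *: m f) = comp (d (nu X) *: g) (d Y *: f).
    rewrite !compZl !compZr -mM cP !scalerA dS; congr (_ *: _); ring.
  split=> XY f; apply/eqP; rewrite -subr_eq0; apply/eqP.
    apply: comp_nondegr => g; apply: (scalerI (dn0 Y)); rewrite scaler0.
    by rewrite -compZr compBl -e XY; exact: subrr.
  apply: comp_nondegl => g; apply: (scalerI (dn0 (nu X))); rewrite scaler0.
  by rewrite -compZl compBr -e XY; exact: subrr.
have lev i : forall x y, good (x, i) (y, i).
  elim/int_shift_ind: i => [x y f|i]; first by rewrite !d0 m_level0.
  split=> h x y.
    exact: (step (y, i) (nu (x, i))).1 ((step (x, i) (y, i)).1 (h x y)).
  exact: (step (x, i) (y, i)).2 ((step (y, i) (nu (x, i))).2 (h x y)).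
move=> [x i] [y j].
have [->|ji] := eqVneq j i; first exact: lev.
have [->|ji1] := eqVneq j (i + 1); first exact: (step (y, i) (x, i)).1 (lev i y x).
move=> f; have -> : f = 0 by apply: hat_eq; [rewrite !hatA0 | rewrite !hatD0].
by rewrite inner0 !scaler0.
Qed.

End Inner.
End Nakayama.

(** * Zero parts and twists *)

Section ZeroPart.
Context (k : closedFieldType) (A : basicAlg k).
Local Notation H := (hat A).
Local Notation nu := (nakayama A).

Lemma arr_hatA (X Y X' Y' : H) (f : hom X Y) (f' : hom X' Y') :
  arr f = arr f' ->
  arr (hatA f : @hom k (algCat A) _ _) = arr (hatA f' : @hom k (algCat A) _ _).
Proof. by move=> e; have [eX eY] := arr_ob e; subst; rewrite (arr_inj e). Qed.

Lemma hatEmb_inj i (s t : linFunctor (algCat A) (algCat A)) :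
  fcomp (hatEmb A i) s = fcomp (hatEmb A i) t -> s = t.
Proof.
move=> e; apply: functor_eq => x y f.
have := arr_hatA (congr1 (fun F : linFunctor _ _ => arr (fmap F f)) e).
by rewrite ![hatA _](hatA_emb i).
Qed.

Lemma hatEmbA i (X Y : H) (h : hom X Y) : X.2 = i -> Y.2 = i ->
  arr (fmap (hatEmb A i) (hatA h)) = arr h.
Proof.
case: X Y h => x j [y l] h /= ej el; subst j l.
apply: (@hat_arr _ _ x y i i i i) => //; rewrite ?hatA_emb ?hatD_emb // hatD0 //=.
by rewrite -[X in X != _]addr0 (inj_eq (addrI _)).
Qed.

(** The restriction of F to level 0, followed by the projection to A. Projecting
    instead of casting makes this a functor for every F; it is an honest
    restriction as soon as F preserves level 0. *)
Definition restrHom (F : linFunctor H H) x y (f : Ahom (A := A) x y) :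
  Ahom (F (x, 0)).1 (F (y, 0)).1 := hatA (fmap F (fmap (hatEmb A 0) f)).

Definition restr (F : linFunctor H H) : linFunctor (algCat A) (algCat A).
Proof.
refine (@LinFunctor k (algCat A) (algCat A) (fun x => (F (x, 0)).1)
  (@restrHom F) _ _ _).
- by move=> x y a f g; rewrite /restrHom !fmap_lin hatA_lin.
- by move=> x; rewrite /restrHom !fmap1; exact: hatA_idm.
- by move=> x y z g f; rewrite /restrHom !fmapM; exact: hatA_comp.
Defined.

Lemma restrE (F : linFunctor H H) : (forall x, (F (x, 0)).2 = 0) ->
  fcomp (hatEmb A 0) (restr F) = fcomp F (hatEmb A 0).
Proof. by move=> F0; apply: functor_eq => x y f; exact: hatEmbA. Qed.

Lemma nakayama_pow_ob i x j : isoPow nu i (x, j) = (x, j + i).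
Proof.
elim/int_shift_ind: i => [|i]; first by rewrite addr0.
rewrite isoPowS_ob addrA; split=> [-> //|].
exact: (can_inj (isoV_ob nu) (x2 := (x, j + i))).
Qed.

Lemma hatFun_emb (s : catIso (algCat A) (algCat A)) i :
  fcomp (hatIso s) (hatEmb A i) = fcomp (hatEmb A i) s.
Proof.
apply: functor_eq => x y f; apply: (@hat_arr _ _ (s x) (s y) i i) => //.
  apply: etrans (hatA_f s (embHom i f)) _.
  by rewrite hatA_emb; apply: etrans (esym (hatA_emb i _)).
apply: etrans (hatD_f s (embHom i f)) _.
by rewrite hatD_emb hatfD0; apply: esym; exact: (hatD_emb i (fmapA s f)).
Qed.

Section Jump.
Hypothesis acyclic : no_nonzero_oriented_cycles A.
Context (phi : catIso H H) (n : int).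

(** A jump constrains phi on level 0 only; commutation with nu spreads it to the
    other levels. *)
Lemma jump_level : has_jump phi n -> forall X, (phi X).2 = X.2 + n.
Proof.
move=> jump [x i]; elim/int_shift_ind: i => [|i].
  have : [set phi X | X in @level k A 0]%classic (phi (x, 0)) by exists (x, 0).
  by rewrite jump add0r.
have -> : phi (x, i + 1) = nu (phi (x, i)) by exact: (iso_nakayama_ob acyclic phi (x, i)).
rewrite /= addrAC; split=> [-> //|]; exact: addIr.
Qed.

Lemma zero_part_exists : has_jump phi n ->
  exists s : catIso (algCat A) (algCat A), is_zero_part phi n s.
Proof.
move=> jump; pose F := isoComp phi (isoPow nu (- n)).
have F2 X : (F X).2 = X.2.
  by case: X => x i; rewrite [LHS](jump_level jump) nakayama_pow_ob /= subrK.
have V2 X : (isoV F X).2 = X.2 by rewrite -F2 iso_ob.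
have FE := restrE (fun x => F2 (x, 0)); have VE := restrE (fun x => V2 (x, 0)).
have VF : fcomp (restr (isoV F)) (restr F) = fid (algCat A).
  by apply: (@hatEmb_inj 0); rewrite fcompA VE -fcompA FE fcompA isoVK fcompF1 fcomp1F.
have FV : fcomp (restr F) (restr (isoV F)) = fid (algCat A).
  by apply: (@hatEmb_inj 0); rewrite fcompA FE -fcompA VE fcompA isoK fcompF1 fcomp1F.
by exists (CatIso VF FV).
Qed.

(** Commutation with nu on objects makes e fix every object, not only those of
    level 0. *)
Lemma inner_of_level0 (e : catIso H H) :
  fcomp e (hatEmb A 0) = hatEmb A 0 ->
  exists2 d : H -> k, forall X, d X != 0 &
    forall X Y (f : hom X Y), arr (d X *: fmap e f) = arr (d Y *: f).
Proof.
move=> e0.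
have eob : forall X, e X = X.
  case=> x i; elim/int_shift_ind: i => [|i].
    exact: (congr1 (fun F : linFunctor (algCat A) H => F x) e0).
  have -> : e (x, i + 1) = nu (e (x, i)) by exact: (iso_nakayama_ob acyclic e (x, i)).
  split=> [-> //|]; exact: (can_inj (isoV_ob nu) (x2 := (x, i))).
pose m X Y (f : hom X Y) := cast2 (eob X) (eob Y) (fmap e f).
have mE X Y (f : hom X Y) : arr (m X Y f) = arr (fmap e f) by exact: arr_cast2.
have [||||d d0 dP] := @inner_scalars k A acyclic m.
- by move=> X Y a f g; rewrite /m fmap_lin cast2_lin.
- move=> X Y f /(congr1 (@arr _ _ _ _)); rewrite mE => mf0.
  apply: (@iso_inj _ _ _ e); rewrite fmap0; apply: arr_inj.
  by rewrite mf0; apply: arr0.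
- move=> X Y Z g f; apply: arr_inj; rewrite mE fmapM.
  by apply: arr_comp; rewrite mE.
- move=> x y f; apply: arr_inj; rewrite mE.
  have -> : f = fmap (hatEmb A 0) (hatA f).
    by apply: arr_inj; rewrite [RHS](@hatEmbA 0 (x, 0) (y, 0) f).
  exact: (congr1 (fun F : linFunctor (algCat A) H =>
    arr (fmap F (hatA f : @hom k (algCat A) x y))) e0).
- exists d => // X Y f; rewrite -dP; apply: arr_scale; exact/esym/mE.
Qed.

(** The twist by s and phi have the same restriction to level -n; so
    phi nu^-n and the extension of s differ by an automorphism that is the
    identity on level 0. *)
Lemma twist_inner (s : catIso (algCat A) (algCat A)) : is_zero_part phi n s ->
  exists2 d : H -> k, forall X, d X != 0 &
    forall X Y (f : hom X Y),
      arr (d X *: fmap phi f) = arr (d Y *: fmap (twist s n) f).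
Proof.
move=> sP; pose F := isoComp phi (isoPow nu (- n)).
have [|d d0 dP] := @inner_of_level0 (isoComp (isoInv (hatIso s)) F).
  by rewrite -fcompA -sP -hatFun_emb fcompA isoVK fcomp1F.
exists (fun X => d (isoPow nu n X)) => // X Y f.
have := arr_fmap (hatIso s) (dP _ _ (fmap (isoPow nu n) f)).
rewrite !fmapZ => <-; apply: arr_scale; rewrite isoKa.
have : fcomp F (isoPow nu n) = phi.
  by rewrite -fcompA isoPowD addNr fcompF1.
by move/(congr1 (fun G : linFunctor _ _ => arr (fmap G f))) => <-.
Qed.

End Jump.
End ZeroPart.

Theorem corollary4p3 (k : closedFieldType) (A : basicAlg k) (n : int)
    (phi : catIso (hat A) (hat A)) :
  no_nonzero_oriented_cycles A ->
  n != 0 ->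
  has_jump phi n ->
  (exists phi0 : catIso (algCat A) (algCat A), is_zero_part phi n phi0) /\
  (forall phi0 : catIso (algCat A) (algCat A), is_zero_part phi n phi0 ->
    forall (r : orbitReps phi) (r' : orbitReps (twist phi0 n)),
      gr_isomorphic (orbitCat r) (twistedExt r')).
Proof.
move=> acyclic _ jump; split; first exact: zero_part_exists.
move=> phi0 phi0P r r'; have [d d0 dP] := twist_inner acyclic phi0P.
exact: (orbitCat_iso d0 dP).
Qed.
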